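(* For any memory cell $\mathcal{S}_{\mathcal{X}}=\{\mathcal{N}^x_{A\to B}\}_{x\in\mathcal{X}}$, $$\mathcal{C}(\mathcal{S}_{\mathcal{X}})\le\sup_{\rho_{XRA}}\big[I(X;B|R)_\omega-I(X;A|R)_\rho\big],$$ where the supremum is over classical–quantum states $\rho_{XRA}=\sum_{x}p_X(x)|x\rangle\langle x|_X\otimes\rho^x_{RA}$ (with $p_X$ a distribution on $\mathcal{X}$, $\rho^x_{RA}$ states, and $\mathcal{H}_R$ of arbitrary finite dimension), and $\omega_{XRB}=\sum_xp_X(x)|x\rangle\langle x|_X\otimes\mathcal{N}^x_{A\to B}(\rho^x_{RA})$.
   Context: Finite $\mathcal{X}$, finite-dimensional $A,B$. An $(n,R,\varepsilon)$ quantum reading protocol: message set $\mathcal{M}$, $R=\frac1n\log_2|\mathcal{M}|$, encoding $m\mapsto x^n(m)\in\mathcal{X}^n$, adaptive strategy (initial state $\rho_{R_1A_1}$, interleaved channels $\mathcal{A}^i_{R_iB_i\to R_{i+1}A_{i+1}}$ for $i=1,\dots,n-1$, final POVM $\{\Lambda^{\hat m}_{R_nB_n}\}$, where the $i$-th call applies $\mathcal{N}^{x_i(m)}$ to $A_i$), with $\frac1{|\mathcal{M}|}\sum_m\mathrm{Tr}\{\Lambda^m(\mathcal{N}^{x_n(m)}\circ\mathcal{A}^{n-1}\circ\cdots\circ\mathcal{A}^1\circ\mathcal{N}^{x_1(m)})(\rho_{R_1A_1})\}\ge1-\varepsilon$. $R$ is achievable if for all $\varepsilon\in(0,1)$, $\delta>0$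 and large $n$ an $(n,R-\delta,\varepsilon)$ protocol exists; the quantum reading capacity $\mathcal{C}$ is the supremum of achievable rates. $I(X;B|R)$ is conditional quantum mutual information. *)

(* Defs.v *)
From HB Require Import structures.
From mathcomp Require Import all_boot all_order all_algebra.
From mathcomp Require Import complex.
From mathcomp Require Import boolp classical_sets reals constructive_ereal ereal exp.
Set Implicit Arguments. Unset Strict Implicit. Unset Printing Implicit Defensive.
Import Order.TTheory GRing.Theory Num.Theory.
Local Open Scope ring_scope.
Local Open Scope complex_scope.

(* A quantum system is given by a finite type T (an orthonormal basis  *)
(* of its Hilbert space C^T); operators on it are T x T matrices.       *)
(* Composite system of T and U is the product type T * U.               *)

Definition op (R : realType) (T : finType) := T -> T -> R[i].

Definition tr (R : realType) (T : finType) (X : op R T) : R[i] :=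
  \sum_(t : T) X t t.

Definition opmul (R : realType) (T : finType) (X Y : op R T) : op R T :=
  fun i j => \sum_(k : T) X i k * Y k j.

Definition idop (R : realType) (T : finType) : op R T :=
  fun i j => (i == j)%:R.

(* positive semidefinite: <v, X v> >= 0 for every vector v
   (in the partial order of C, i.e. real and nonnegative) *)
Definition psd (R : realType) (T : finType) (X : op R T) : Prop :=
  forall v : T -> R[i],
    0 <= \sum_(i : T) \sum_(j : T) (v i)^* * X i j * v j.

Definition density (R : realType) (T : finType) (X : op R T) : Prop :=
  psd X /\ tr X = 1.

Definition povm (R : realType) (M T : finType) (L : M -> op R T) : Prop :=
  (forall m, psd (L m)) /\ (fun i j => \sum_(m : M) L m i j) = @idop R T.

Definition oplinear (R : realType) (T U : finType) (N : op R T -> op R U) : Prop :=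
  forall (c : R[i]) (X Y : op R T),
    N (fun i j => c * X i j + Y i j) = (fun i j => c * N X i j + N Y i j).

Definition id_tens (R : realType) (E T U : finType) (N : op R T -> op R U)
  (X : op R (E * T)%type) : op R (E * U)%type :=
  fun p q => N (fun a a' => X (p.1, a) (q.1, a')) p.2 q.2.

Definition compl_pos (R : realType) (T U : finType) (N : op R T -> op R U) : Prop :=
  forall (E : finType) (X : op R (E * T)%type), psd X -> psd (id_tens N X).

Definition trace_pres (R : realType) (T U : finType) (N : op R T -> op R U) : Prop :=
  forall X : op R T, tr (N X) = tr X.

Definition channel (R : realType) (T U : finType) (N : op R T -> op R U) : Prop :=
  [/\ oplinear N, compl_pos N & trace_pres N].

(* von Neumann entropy (base 2): H(X) = - Tr X log2 X = - sum l log2 l *)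
(* over the eigenvalues l of X counted with multiplicity (the roots of  *)
(* its characteristic polynomial), with 0 log 0 = 0.                   *)

Definition log2 (R : realType) (x : R) : R := ln x / ln 2.

Definition mx_of (R : realType) (T : finType) (X : op R T) : 'M[R[i]]_#|T| :=
  \matrix_(i, j) X (enum_val i) (enum_val j).

Definition eigvals (R : realType) (T : finType) (X : op R T) : seq R[i] :=
  sval (closed_field_poly_normal (char_poly (mx_of X))).

Definition entropy (R : realType) (T : finType) (X : op R T) : R :=
  \sum_(l <- eigvals X) (if 0 < complex.Re l then - (complex.Re l * log2 (complex.Re l)) else 0).

Definition ptr2 (R : realType) (T U : finType) (X : op R (T * U)%type) : op R T :=
  fun t t' => \sum_(u : U) X (t, u) (t', u).
Definition ptr1 (R : realType) (T U : finType) (X : op R (T * U)%type) : op R U :=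
  fun u u' => \sum_(t : T) X (t, u) (t, u').
Definition ptr1_3 (R : realType) (T1 T2 T3 : finType) (X : op R ((T1 * T2) * T3)%type)
  : op R (T2 * T3)%type :=
  fun p q => \sum_(t : T1) X ((t, p.1), p.2) ((t, q.1), q.2).

(* conditional mutual information I(1;3|2) of a state on (1 2) 3:
   I(1;3|2) = H(12) + H(23) - H(2) - H(123) *)
Definition cmi (R : realType) (T1 T2 T3 : finType) (X : op R ((T1 * T2) * T3)%type) : R :=
  entropy (ptr2 X) + entropy (ptr1_3 X) - entropy (ptr1 (ptr2 X)) - entropy X.

(* classical-quantum state sum_x p(x) |x><x|_X (x) rho^x_{EA}, on (X E) A *)
Definition cqstate (R : realType) (X E A : finType) (p : X -> R)
  (rho : X -> op R (E * A)%type) : op R ((X * E) * A)%type :=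
  fun u v => if u.1.1 == v.1.1
             then (p u.1.1)%:C * rho u.1.1 (u.1.2, u.2) (v.1.2, v.2) else 0.

Definition prob_distr (R : realType) (X : finType) (p : X -> R) : Prop :=
  (forall x, 0 <= p x) /\ \sum_(x : X) p x = 1.

(* Memory systems R_i are Rs i (i = 0, ..., n-1 in 0-based indexing),   *)
(* rho0 is the initial state on R_0 A, ad k : R_k B -> R_{k+1} A are    *)
(* the interleaved channels, xs the codeword (only xs 0..n-1 matter).   *)
(* run k is the state on R_k B after the (k+1)-th call of the cell.     *)

Fixpoint run (R : realType) (X A B : finType) (N : X -> op R A -> op R B)
  (Rs : nat -> finType) (rho0 : op R (Rs 0 * A)%type)
  (ad : forall k, op R (Rs k * B)%type -> op R (Rs k.+1 * A)%type)
  (xs : nat -> X) (k : nat) : op R (Rs k * B)%type :=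
  match k return op R (Rs k * B)%type with
  | 0 => id_tens (N (xs 0)) rho0
  | k'.+1 => id_tens (N (xs k'.+1)) (ad k' (@run R X A B N Rs rho0 ad xs k'))
  end.
Arguments run {R X A B} N {Rs} rho0 ad xs k.

(* existence of an (n, rate, eps) quantum reading protocol (n >= 1 calls);
   the rate (1/n) log2 |M| is required to be at least [rate] *)
Definition reading_protocol (R : realType) (X A B : finType)
  (N : X -> op R A -> op R B) (n : nat) (rate eps : R) : Prop :=
  exists (M : finType) (enc : M -> nat -> X) (Rs : nat -> finType)
         (rho0 : op R (Rs 0 * A)%type)
         (ad : forall k, op R (Rs k * B)%type -> op R (Rs k.+1 * A)%type)
         (Lam : M -> op R (Rs n.-1 * B)%type),
    [/\ density rho0,
        (forall k, (k < n.-1)%N -> channel (ad k)),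
        povm Lam,
        rate <= log2 (#|M|%:R) / n%:R
      & 1 - eps <= complex.Re ((#|M|%:R)^-1 *
            \sum_(m : M) tr (opmul (Lam m) (run N rho0 ad (enc m) n.-1)))].

Definition achievable (R : realType) (X A B : finType)
  (N : X -> op R A -> op R B) (r : R) : Prop :=
  forall eps delta : R, 0 < eps < 1 -> 0 < delta ->
    exists n0 : nat, forall n : nat, (n0 <= n)%N -> (0 < n)%N ->
      reading_protocol N n (r - delta) eps.

Definition reading_capacity (R : realType) (X A B : finType)
  (N : X -> op R A -> op R B) : \bar R :=
  ereal_sup [set r%:E | r in achievable N].

Definition cq_bound (R : realType) (X A B : finType)
  (N : X -> op R A -> op R B) : \bar R :=
  ereal_sup [set v | exists (E : finType) (p : X -> R) (rho : X -> op R (E * A)%type),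
     [/\ prob_distr p, (forall x, density (rho x)) &
         v = (cmi (cqstate p (fun x => id_tens (N x) (rho x)))
              - cmi (cqstate p rho))%:E]].

(* Main.v *)
Require Import Defs.
From HB Require Import structures.
From mathcomp Require Import all_boot all_order all_algebra.
From mathcomp Require Import complex.
From mathcomp Require Import boolp classical_sets reals constructive_ereal ereal exp.
From mathcomp Require Import ring lra.
Import Order.TTheory GRing.Theory Num.Theory.
Local Open Scope ring_scope.

(**
  Let chi be the Holevo quantity of the ensemble of states held by the reader, indexed by a uniform
  message. It starts at 0, and it does not increase under the interleaved channels. For cq states the
  difference of conditional mutual informations in the bound is chi(N^x(rho^x)) - chi(rho^x), so after
  averaging the messages that use the same letter [x] each call of the cell increases chi by at most the
  bound. Fano's inequality after the final measurement turns n times the bound into a rate bound.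

  Every monotonicity used here reduces to that of the relative entropy D(rho||sigma) under channels.
  Approximating the logarithm by Riemann sums of ln x = int_0^1 (x - 1) / (1 + s (x - 1)) ds, D is a limit
  of positive combinations of Psi_s - tr rho, where
    Psi_s = sup_Y [2 Re tr(rho Y) - s tr(sigma Y Y^h) - (1 - s) tr(rho Y^h Y)],
  and Psi_s is monotone because the adjoint of a channel satisfies the Schwarz inequality.
*)

Set Implicit Arguments.
Unset Strict Implicit.
Unset Printing Implicit Defensive.
Local Notation "x %:C" := (real_complex _ x) : ring_scope.

(** * Rectangular kernels *)

(** Rectangular, so that column vectors ([U = unit]) and block rows or columns (indexed by
    [bool * T]) share one product with operators. *)
Definition kern (R : realType) (T U : finType) := T -> U -> R[i].

Definition kmul (R : realType) (T U W : finType) (X : kern R T U) (Y : kern R U W) :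
  kern R T W := fun i k => \sum_j X i j * Y j k.

Definition kadj (R : realType) (T U : finType) (X : kern R T U) : kern R U T :=
  fun i j => (X j i)^*.

Definition dg (R : realType) (T : finType) (d : T -> R) : op R T :=
  fun i j => (d i)%:C *+ (i == j).

Declare Scope kern_scope.
Delimit Scope kern_scope with K.
Notation "X ** Y" := (kmul X Y) (at level 40, left associativity) : kern_scope.
Notation "X ^h" := (kadj X) (at level 8, format "X ^h") : kern_scope.
Local Open Scope kern_scope.

Section Kernels.
Variable R : realType.
Local Notation C := R[i].

Lemma conjcE (x : C) : x^* = conjc x.
Proof. by []. Qed.

Lemma kernP (T U : finType) (X Y : kern R T U) : (forall i j, X i j = Y i j) -> X = Y.
Proof. by move=> h; apply/funext => i; apply/funext => j. Qed.

Lemma kmulA (T U W Z : finType) (X : kern R T U) (Y : kern R U W) (V : kern R W Z) :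
  X ** (Y ** V) = X ** Y ** V.
Proof.
apply: kernP => i l; rewrite /kmul.
under eq_bigr => j _ do rewrite big_distrr /=.
rewrite exchange_big /=; apply: eq_bigr => k _; rewrite big_distrl /=.
by apply: eq_bigr => j _; rewrite mulrA.
Qed.

Lemma kmul1k (T U : finType) (X : kern R T U) : @idop R T ** X = X.
Proof.
apply: kernP => i k; rewrite /kmul /idop (bigD1 i) //= eqxx mul1r big1 ?addr0 //.
by move=> j ji; rewrite eq_sym (negbTE ji) mul0r.
Qed.

Lemma kmulk1 (T U : finType) (X : kern R T U) : X ** @idop R U = X.
Proof.
apply: kernP => i k; rewrite /kmul /idop (bigD1 k) //= eqxx mulr1 big1 ?addr0 //.
by move=> j ji; rewrite (negbTE ji) mulr0.
Qed.

Lemma kadjM (T U W : finType) (X : kern R T U) (Y : kern R U W) :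
  (X ** Y)^h = Y^h ** X^h.
Proof.
apply: kernP => i j; rewrite /kadj /kmul rmorph_sum /=.
by apply: eq_bigr => k _; rewrite rmorphM mulrC.
Qed.

Lemma kadjK (T U : finType) (X : kern R T U) : X^h^h = X.
Proof. by apply: kernP => i j; rewrite /kadj conjCK. Qed.

Lemma tr_kmulC (T U : finType) (X : kern R T U) (Y : kern R U T) :
  tr (X ** Y) = tr (Y ** X).
Proof.
rewrite /tr /kmul exchange_big /=; apply: eq_bigr => i _.
by apply: eq_bigr => j _; rewrite mulrC.
Qed.

Lemma tr_adj (T : finType) (X : op R T) : tr (X^h) = (tr X)^*.
Proof. by rewrite /tr rmorph_sum. Qed.

Lemma kmulDr (T U W : finType) c (X : kern R T U) (Y Y' : kern R U W) :
  X ** (fun i j => c * Y i j + Y' i j)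
  = fun i j => c * (X ** Y) i j + (X ** Y') i j.
Proof.
apply: kernP => i j; rewrite /kmul big_distrr -big_split /=.
by apply: eq_bigr => k _; rewrite mulrDr mulrCA.
Qed.

Lemma trD (T : finType) c (X Y : op R T) :
  tr (fun i j => c * X i j + Y i j) = c * tr X + tr Y.
Proof. by rewrite /tr big_split big_distrr. Qed.

Lemma tr_dgM (T : finType) (d : T -> R) (X : op R T) :
  tr (dg d ** X) = \sum_i (d i)%:C * X i i.
Proof.
apply: eq_bigr => i _; rewrite /kmul /dg (bigD1 i) //= eqxx big1 ?addr0 //.
by move=> j ji; rewrite eq_sym (negbTE ji) mul0r.
Qed.

(** * Positive semidefinite operators *)

Lemma quad_formE (T : finType) (X : op R T) (v : T -> C) :
  let V : kern R T unit := fun t _ => v t in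
  \sum_i \sum_j (v i)^* * X i j * v j = (V^h ** X ** V) tt tt.
Proof.
rewrite /= /kmul exchange_big /=; apply: eq_bigr => j _.
by rewrite big_distrl /=; apply: eq_bigr.
Qed.

Lemma psd_conj (T U : finType) (V : kern R U T) (X : op R T) :
  psd X -> psd (V ** X ** V^h).
Proof.
move=> hX v; rewrite quad_formE /=.
set W : kern R U unit := fun t _ => v t.
have := hX (fun t => (V^h ** W) t tt); rewrite quad_formE /=.
congr (0 <= _); set Z := (fun t _ => _).
have -> : Z = V^h ** W by apply: kernP => i [].
by rewrite kadjM kadjK !kmulA.
Qed.

Lemma sum_only1 (T : finType) (F : T -> C) i :
  (forall k, k != i -> F k = 0) -> \sum_k F k = F i.
Proof. by move=> h; rewrite (bigD1 i) //= big1 ?addr0. Qed.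

Lemma sum_only2 (T : finType) (F : T -> C) i j : i != j ->
  (forall k, k != i -> k != j -> F k = 0) -> \sum_k F k = F i + F j.
Proof.
move=> ij h; rewrite (bigD1 i) //= (bigD1 j) 1?eq_sym //= big1 ?addr0 //.
by move=> k /andP[]; apply: h.
Qed.

Lemma psd_diag (T : finType) (X : op R T) i : psd X -> 0 <= X i i.
Proof.
move=> /(_ (fun j => if j == i then 1 else 0)).
rewrite (@sum_only1 _ _ i) => [|k ki]; last first.
  by apply: big1 => l _; rewrite (negbTE ki) conjC0 !mul0r.
rewrite (@sum_only1 _ _ i) => [|k ki]; last by rewrite (negbTE ki) mulr0.
by rewrite eqxx conjC1 mul1r mulr1.
Qed.

Lemma psd_tr (T : finType) (X : op R T) : psd X -> 0 <= tr X.
Proof. by move=> h; apply: sumr_ge0 => i _; apply: psd_diag. Qed.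

Lemma psd_id (T : finType) : psd (@idop R T).
Proof.
move=> v; rewrite quad_formE /= kmulk1; apply: sumr_ge0 => i _.
by rewrite mulrC mul_conjC_ge0.
Qed.

Lemma psd_gram (T U : finType) (V : kern R T U) : psd (V ** V^h).
Proof. by have := psd_conj V (@psd_id U); rewrite kmulk1. Qed.

Lemma psd_sum (I T : finType) (P : pred I) (c : I -> R) (X : I -> op R T) :
  (forall i, P i -> 0 <= c i) -> (forall i, P i -> psd (X i)) ->
  psd (fun a b => \sum_(i | P i) (c i)%:C * X i a b).
Proof.
move=> hc hX v.
have -> : \sum_i \sum_j (v i)^* * (\sum_(k | P k) (c k)%:C * X k i j) * v j =
  \sum_(k | P k) (c k)%:C * (\sum_i \sum_j (v i)^* * X k i j * v j).
  under [RHS]eq_bigr => k _ do rewrite big_distrr /=.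
  rewrite [RHS]exchange_big /=; apply: eq_bigr => i _.
  under [RHS]eq_bigr => k _ do rewrite big_distrr /=.
  rewrite [RHS]exchange_big /=; apply: eq_bigr => j _.
  rewrite big_distrr big_distrl /=; apply: eq_bigr => k _.
  by rewrite [_^* * _]mulrCA !mulrA.
by apply: sumr_ge0 => k Pk; rewrite mulr_ge0 ?ler0c ?hc //; apply: hX.
Qed.

(** Conjugation by the 0-1 kernel of [f]. As [f] is arbitrary, this covers principal blocks,
    reassociated tensor factors and a trivial ancilla alike. *)
Lemma psd_relabel (T U : finType) (f : U -> T) (X : op R T) : psd X ->
  psd (fun i j => X (f i) (f j)).
Proof.
move=> /(psd_conj (fun u t => if f u == t then 1 else 0)); congr psd; apply: kernP => i j.
rewrite /kmul (@sum_only1 _ _ (f j)) => [|k kj]; last first.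
  by rewrite /kadj eq_sym (negbTE kj) conjC0 mulr0.
rewrite (@sum_only1 _ _ (f i)) => [|k ki]; last by rewrite eq_sym (negbTE ki) mul0r.
by rewrite /kadj !eqxx conjC1 mul1r mulr1.
Qed.

(* Polarisation with the vectors [e_i + c e_j] for [c = 1] and [c = 'i]. *)
Lemma psd_herm (T : finType) (X : op R T) : psd X -> X^h = X.
Proof.
move=> hX; apply: kernP => i j; rewrite /kadj.
have [->|ij] := eqVneq i j.
  exact: geC0_conj (psd_diag j hX).
have hi := psd_diag i hX; have hj := psd_diag j hX.
have key c : 0 <= X i i + c * X i j + (c^* * X j i + (c^* * c) * X j j).
  have /(_ (fun k => if k == i then 1 else if k == j then c else 0)) := hX.
  rewrite (@sum_only2 _ _ i j) // => [|k /negbTE ki /negbTE kj]; last first.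
    by apply: big1 => l _; rewrite ki kj conjC0 !mul0r.
  rewrite !(@sum_only2 _ _ i j) // => [|k /negbTE ki /negbTE kj|k /negbTE ki /negbTE kj];
    try by rewrite ki kj mulr0.
  rewrite !eqxx [j == i]eq_sym (negbTE ij) conjC1 !mul1r !mulr1.
  congr (0 <= _ + _ + (_ + _)); first exact: mulrC.
  by rewrite mulrAC.
move: (key 1) (key ('i)%C); move: hi hj; rewrite !conjcE !lecE /=.
case: (X i i) => a1 a2; case: (X j j) => b1 b2; case: (X i j) => c1 c2; case: (X j i) => d1 d2 /=.
move=> /andP[/eqP -> _] /andP[/eqP -> _] /andP[/eqP h1 _] /andP[/eqP h2 _].
apply/eqP; rewrite eq_complex /=; apply/andP; split; apply/eqP; lra.
Qed.

End Kernels.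

(** * Channels and the Schwarz inequality *)

Section Channels.
Variable R : realType.
Local Notation C := R[i].

Lemma kmulNl (T U W : finType) (X : kern R T U) (Y : kern R U W) :
  (fun i j => - X i j) ** Y = fun i j => - (X ** Y) i j.
Proof.
by apply: kernP => i j; rewrite /kmul -sumrN; apply: eq_bigr => k _; rewrite mulNr.
Qed.

Lemma kmulNr (T U W : finType) (X : kern R T U) (Y : kern R U W) :
  X ** (fun i j => - Y i j) = fun i j => - (X ** Y) i j.
Proof.
by apply: kernP => i j; rewrite /kmul -sumrN; apply: eq_bigr => k _; rewrite mulrN.
Qed.

Lemma kadjN (T U : finType) (X : kern R T U) :
  (fun i j => - X i j)^h = fun i j => - X^h i j.
Proof. by apply: kernP => i j; rewrite /kadj rmorphN. Qed.

Lemma trN (T : finType) (X : op R T) : tr (fun i j => - X i j) = - tr X.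
Proof. by rewrite /tr sumrN. Qed.

Lemma kadj1 (T : finType) : (@idop R T)^h = @idop R T.
Proof. by apply: kernP => i j; rewrite /kadj /idop rmorph_nat eq_sym. Qed.

Lemma kmul_pair (I T U W : finType) (X : kern R T (I * U)%type) (Y : kern R (I * U)%type W) i j :
  (X ** Y) i j =
  \sum_b ((fun t u => X t (b, u)) ** (fun u w => Y (b, u) w)) i j.
Proof. by rewrite /kmul pair_bigA /=; apply: eq_bigr => -[]. Qed.

Variables (T U : finType) (N : op R T -> op R U).

Lemma oplinear0 : oplinear N -> N (fun _ _ => 0) = fun _ _ => 0.
Proof.
move=> /(_ (-1) (fun _ _ => 0) (fun _ _ => 0)).
have -> : (fun _ _ : T => -1 * (0 : C) + 0) = fun _ _ => 0.
  by apply: kernP => i j; rewrite mulr0 addr0.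
by move=> {1}->; apply: kernP => i j; rewrite mulN1r addNr.
Qed.

Lemma oplinearZ c (X : op R T) : oplinear N ->
  N (fun i j => c * X i j) = fun i j => c * N X i j.
Proof.
move=> h; have := h c X (fun _ _ => 0); rewrite oplinear0 //.
under eq_fun do under eq_fun do rewrite addr0.
by move=> ->; apply: kernP => i j; rewrite addr0.
Qed.

Lemma oplinear_sum (I : finType) (P : pred I) (c : I -> C) (X : I -> op R T) : oplinear N ->
  N (fun i j => \sum_(k | P k) c k * X k i j) = fun i j => \sum_(k | P k) c k * N (X k) i j.
Proof.
move=> h; rewrite /index_enum; elim: (Finite.enum I) => [|k r IH].
  transitivity (N (fun _ _ => 0)).
    by congr N; apply: kernP => i j; rewrite big_nil.
  by rewrite oplinear0 //; apply: kernP => i j; rewrite big_nil.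
case: (boolP (P k)) => Pk; last first.
  transitivity (N (fun i j => \sum_(k <- r | P k) c k * X k i j)).
    by congr N; apply: kernP => i j; rewrite big_cons (negbTE Pk).
  by rewrite IH; apply: kernP => i j; rewrite big_cons (negbTE Pk).
transitivity (N (fun i j => c k * X k i j + \sum_(k <- r | P k) c k * X k i j)).
  by congr N; apply: kernP => i j; rewrite big_cons Pk.
by rewrite h IH; apply: kernP => i j; rewrite big_cons Pk.
Qed.

Hypothesis hN : channel N.

Let Nlin : oplinear N. Proof. by case: hN. Qed.
Let Ncp : compl_pos N. Proof. by case: hN. Qed.
Let Ntr : trace_pres N. Proof. by case: hN. Qed.

(** Complete positivity with the one-dimensional ancilla [unit]. *)
Lemma channel_psd (X : op R T) : psd X -> psd (N X).
Proof.
move=> /(psd_relabel (fun p : unit * T => p.2)) /Ncp.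
by move=> /(psd_relabel (fun u => (tt, u))).
Qed.

Lemma channel_density (X : op R T) : density X -> density (N X).
Proof. by move=> [h1 h2]; split; [apply: channel_psd | rewrite Ntr]. Qed.

(* [X] is an off-diagonal block of a Gram operator on [bool * T], which [N] maps to a Hermitian one. *)
Lemma channel_adj (X : op R T) : N (X^h) = (N X)^h.
Proof.
pose V : kern R (bool * T)%type T := fun p k => if p.1 then X p.2 k else @idop R T p.2 k.
have /Ncp/psd_herm hZ := psd_gram V.
apply: kernP => i j; have /(congr1 (fun f => f (false, i) (true, j))) := hZ.
rewrite {1}/kadj /id_tens /=.
rewrite -[fun a a' : T => (V ** V^h) (true, a) (false, a')]/(X ** (@idop R T)^h).
rewrite -[fun a a' : T => (V ** V^h) (false, a) (true, a')]/(@idop R T ** X^h).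
by rewrite kadj1 kmulk1 kmul1k => <-.
Qed.

(** The Heisenberg-picture adjoint of [N], read off from the images of the matrix units; [tr_chadj]
    is its defining duality. *)
Definition chadj (Y : op R U) : op R T :=
  fun b a => tr (N (fun i j => ((i == a) && (j == b))%:R) ** Y).

Lemma tr_chadj (X : op R T) (Y : op R U) : tr (N X ** Y) = tr (X ** chadj Y).
Proof.
have {1}-> : X = fun i j => \sum_(p : T * T) X p.1 p.2 * ((i == p.1) && (j == p.2))%:R.
  apply: kernP => i j; rewrite (@sum_only1 _ _ _ (i, j)) /= ?eqxx ?mulr1 //.
  case=> a b; rewrite xpair_eqE /= [a == _]eq_sym [b == _]eq_sym.
  by case: (_ && _) => //= _; rewrite mulr0.
rewrite oplinear_sum // /tr /kmul.
transitivity (\sum_(p : T * T) X p.1 p.2 * chadj Y p.2 p.1); last first.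
  by rewrite -(pair_bigA _ (fun a b => X a b * chadj Y b a)).
rewrite /chadj /tr /kmul.
under [RHS]eq_bigr => p _ do rewrite big_distrr /=.
rewrite [RHS]exchange_big /=; apply: eq_bigr => i _.
under [RHS]eq_bigr => p _ do rewrite big_distrr /=.
rewrite [RHS]exchange_big /=; apply: eq_bigr => j _.
by rewrite big_distrl /=; apply: eq_bigr => p _; rewrite mulrA.
Qed.

Lemma chadj_adj (Y : op R U) : chadj (Y^h) = (chadj Y)^h.
Proof.
apply: kernP => b a; rewrite /chadj [RHS]/(kadj _ _ _) -tr_adj kadjM -channel_adj [RHS]tr_kmulC.
congr (tr (N _ ** _)).
by apply: kernP => i j; rewrite /kadj rmorph_nat andbC.
Qed.

(* Pair the image of the psd block operator [[rho, - rho Y'*], [- Y' rho, Y' rho Y'*]] with the psd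
   block operator [[Y* Y, Y*], [Y, 1]]. *)
Lemma channel_schwarz (rho : op R T) (Y : op R U) : psd rho ->
  tr (rho ** ((chadj Y)^h ** chadj Y)) <= tr (N rho ** (Y^h ** Y)).
Proof.
move=> hr; set Y' := chadj Y; rewrite -subr_ge0.
pose K : op R T := fun i j => - Y' i j.
pose Vb (b : bool) := if b then @idop R T else K.
pose Pb (b : bool) := if b then Y else @idop R U.
pose V : kern R (bool * T)%type T := fun p k => Vb p.1 p.2 k.
pose P : kern R U (bool * U)%type := fun u q => Pb q.1 u q.2.
have := psd_tr (psd_conj P (Ncp (psd_conj V hr))); congr (0 <= _).
set W := id_tens N _.
have WE b b' : (fun u w => W (b, u) (b', w)) = N (Vb b ** rho ** (Vb b')^h) by [].
transitivity (\sum_(b : bool) \sum_(b' : bool)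
  tr (Pb b ** (fun u w => W (b, u) (b', w)) ** (Pb b')^h)).
  rewrite exchange_big /= [LHS](eq_bigr (fun i => \sum_(b' : bool) \sum_(b : bool)
     (Pb b ** (fun u w => W (b, u) (b', w)) ** (Pb b')^h) i i)).
    rewrite exchange_big /=; apply: eq_bigr => b' _.
    by rewrite exchange_big /=.
  move=> i _; rewrite kmul_pair; apply: eq_bigr => b' _.
  rewrite /kmul exchange_big /=; apply: eq_bigr => u _; rewrite -big_distrl /=; congr (_ * _).
  exact: kmul_pair.
(* The (true, true) block gives the trace with [N rho]. Each mixed block gives minus the trace with
   [rho], and (false, false) gives plus that trace, so the total is the desired difference. *)
rewrite !big_bool !WE /= !kadj1 !kmulk1 !kmul1k.
have -> : tr (Y ** N rho ** Y^h) = tr (N rho ** (Y^h ** Y)).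
  by rewrite -kmulA tr_kmulC kmulA.
have -> : tr (Y ** N (rho ** K^h)) = - tr (rho ** (Y'^h ** Y')).
  by rewrite tr_kmulC tr_chadj -/Y' kadjN kmulNr kmulNl trN kmulA.
have -> : tr (N (K ** rho) ** Y^h) = - tr (rho ** (Y'^h ** Y')).
  rewrite tr_chadj chadj_adj -/Y' !kmulNl trN -kmulA tr_kmulC.
  by rewrite kmulA.
have -> : tr (N (K ** rho ** K^h)) = tr (rho ** (Y'^h ** Y')).
  rewrite Ntr kadjN kmulNr trN !kmulNl trN opprK -kmulA tr_kmulC.
  by rewrite kmulA.
by rewrite addNr addr0.
Qed.

End Channels.

(** * Spectral decompositions and entropy *)

Section Spectral.
Variable R : realType.
Local Notation C := R[i].

Definition unitary (T : finType) (V : op R T) := V ** V^h = @idop R T /\ V^h ** V = @idop R T.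

(** The decomposition is carried as explicit data because [V] and [p] are not unique; [entropy_spec]
    makes the entropy computable from any choice. *)
Definition spec (T : finType) (X V : op R T) (p : T -> R) :=
  [/\ unitary V, (forall i, 0 <= p i) & X = V ** dg p ** V^h].

Definition op_of (T : finType) (M : 'M[C]_#|T|) : op R T :=
  fun i j => M (enum_rank i) (enum_rank j).

Lemma op_ofK (T : finType) (M : 'M[C]_#|T|) : mx_of (op_of M) = M.
Proof. by apply/matrixP => i j; rewrite mxE /op_of !enum_valK. Qed.

Lemma mx_ofK (T : finType) (X : op R T) : op_of (mx_of X) = X.
Proof. by apply: kernP => i j; rewrite /op_of mxE !enum_rankK. Qed.

Lemma mx_ofM (T : finType) (X Y : op R T) : mx_of (X ** Y) = mx_of X *m mx_of Y.
Proof.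
apply/matrixP => i j; rewrite !mxE /kmul.
rewrite (reindex (@enum_val T T)) /=; last exact: onW_bij (enum_val_bij T).
by apply: eq_bigr => k _; rewrite !mxE.
Qed.

Lemma mx_of1 (T : finType) : mx_of (@idop R T) = 1%:M.
Proof.
by apply/matrixP => i j; rewrite !mxE /idop (inj_eq enum_val_inj).
Qed.

Lemma mx_of_adj (T : finType) (X : op R T) : mx_of (X^h) = map_mx Num.conj (mx_of X)^T.
Proof. by apply/matrixP => i j; rewrite !mxE. Qed.

Lemma mx_of_inj (T : finType) : injective (@mx_of R T).
Proof. exact: can_inj (@mx_ofK T). Qed.

Lemma unitary_diag (T : finType) (V X : op R T) (p : T -> R) : unitary V ->
  X = V ** dg p ** V^h -> V^h ** X ** V = dg p.
Proof.
by move=> [_ h] ->; rewrite !kmulA h kmul1k -kmulA h kmulk1.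
Qed.

Lemma spectral (T : finType) (X : op R T) : psd X -> exists V p, spec X V p.
Proof.
move=> hX; have := mx_of_adj X; rewrite (psd_herm hX) => hA.
have /orthomx_spectralP : mx_of X \is normalmx by apply/normalmxP; rewrite -hA.
set P := spectralmx _; set d := spectral_diag _ => eA.
have Pu : P \is unitarymx := spectral_unitarymx _.
have hu : P *m map_mx Num.conj P^T = 1%:M by apply/unitarymxP.
have hu' : map_mx Num.conj P^T *m P = 1%:M by rewrite -invmx_unitary // mulVmx // unitarymx_unit.
pose V := (op_of P)^h.
have eP : mx_of (V^h) = P by rewrite /V kadjK op_ofK.
have eP' : mx_of V = map_mx Num.conj P^T by rewrite /V mx_of_adj op_ofK.
have uV : unitary V.
  by split; apply: mx_of_inj; rewrite mx_ofM eP eP' mx_of1.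
pose D : op R T := V^h ** X ** V.
have eD : mx_of D = diag_mx d.
  by rewrite /D !mx_ofM eP eP' eA invmx_unitary // !mulmxA hu mul1mx -mulmxA hu mulmx1.
have Dpsd : psd D by have := psd_conj (V^h) hX; rewrite kadjK.
(* [D] is diagonal by the spectral theorem and psd by conjugation, so its diagonal entries are real
   and nonnegative: these are the eigenvalues. *)
have Dd i j : D i j = (complex.Re (D i i))%:C *+ (i == j).
  have [<-|ij] := eqVneq i j.
    by have := psd_diag i Dpsd; rewrite mulr1n => /ger0_real /RRe_real.
  rewrite mulr0n -[D]mx_ofK eD /op_of mxE (inj_eq enum_rank_inj).
  by rewrite (negbTE ij).
exists V, (fun i => complex.Re (D i i)); split=> //.
  by move=> i; have := psd_diag i Dpsd; rewrite lecE => /andP[].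
have -> : dg (fun i => complex.Re (D i i)) = D by apply: kernP => i j; rewrite Dd.
by rewrite /D !kmulA uV.1 kmul1k -kmulA uV.1 kmulk1.
Qed.

Definition eta (x : R) : R := - (x * log2 x).

Lemma eta0 : eta 0 = 0. Proof. by rewrite /eta mul0r oppr0. Qed.

(** Similar matrices share their characteristic polynomial, and that of [dg p] is the product of the
    factors X - p i; comparing linear factors identifies [eigvals X] with [p] up to order. *)
Lemma entropy_spec (T : finType) (X V : op R T) p : spec X V p -> entropy X = \sum_i eta (p i).
Proof.
move=> [[uV uV'] p0 eX].
have hu : mx_of V *m mx_of (V^h) = 1%:M by rewrite -mx_ofM uV mx_of1.
pose D := mx_of (dg p).
have eA : char_poly (mx_of X) = char_poly D.
  have eX' : mx_of X = mx_of V *m D *m mx_of (V^h) by rewrite eX !mx_ofM.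
  rewrite /char_poly /char_poly_mx.
  set Vp := map_mx polyC (mx_of V); set Wp := map_mx polyC (mx_of (V^h)).
  have h1 : Vp *m Wp = 1%:M by rewrite -map_mxM hu map_mx1.
  have -> : 'X%:M - map_mx polyC (mx_of X) = Vp *m ('X%:M - map_mx polyC D) *m Wp.
    rewrite mulmxBr mulmxBl eX' !map_mxM /= -/Vp -/Wp; congr (_ - _).
    by rewrite scalar_mxC -mulmxA h1 mulmx1.
  rewrite !det_mulmx mulrAC -det_mulmx h1 det1 mul1r //.
have eC : char_poly D = \prod_(i <- enum T) ('X - ((p i)%:C)%:P).
  have Dt : is_trig_mx D.
    apply/is_trig_mxP => i j ij; rewrite mxE /dg (inj_eq enum_val_inj).
    by case: eqVneq => [e|//]; move: ij; rewrite e ltnn.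
  rewrite char_poly_trig // big_enum /=.
  rewrite [RHS](reindex (@enum_val T T)) /=; last exact: onW_bij (enum_val_bij T).
  by apply: eq_bigr => i _; rewrite mxE /dg eqxx.
have : perm_eq (eigvals X) [seq (p i)%:C | i <- enum T].
  apply: prod_XsubC_eq; rewrite big_map -eC -eA /eigvals.
  case: (closed_field_poly_normal _) => r /= ->.
  have -> : lead_coef (char_poly (mx_of X)) = 1 by apply/monicP; apply: char_poly_monic.
  by rewrite scale1r.
move=> /(perm_big _) e; rewrite /entropy (e _ _ _ _) /= big_map big_enum /=.
apply: eq_bigr => i _; rewrite /eta; case: ltP => // h.
by have -> : p i = 0; [apply/eqP; rewrite eq_le h p0 | rewrite mul0r oppr0].
Qed.

Lemma spec_relabel (T U : finType) (f : U -> T) (X V : op R T) p : bijective f -> spec X V p ->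
  spec (fun i j => X (f i) (f j)) (fun i j => V (f i) (f j)) (p \o f).
Proof.
move=> bf [[h1 h2] p0 ->].
have fi := bij_inj bf.
have eM (Y Z : op R T) : (fun i j => (Y ** Z) (f i) (f j))
   = (fun i j => Y (f i) (f j)) ** (fun i j => Z (f i) (f j)).
  by apply: kernP => i j; rewrite /kmul (reindex f) //=; apply: onW_bij.
have e1 : (fun i j => @idop R T (f i) (f j)) = @idop R U.
  by apply: kernP => i j; rewrite /idop (inj_eq fi).
have ed : (fun i j => dg p (f i) (f j)) = dg (p \o f).
  by apply: kernP => i j; rewrite /dg (inj_eq fi).
split.
- split.
    by rewrite -[X in _ ** X]/(fun i j => V^h (f i) (f j)) -eM h1 e1.
  by rewrite -[X in X ** _]/(fun i j => V^h (f i) (f j)) -eM h2 e1.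
- by move=> i; apply: p0.
- by rewrite !eM ed.
Qed.

Lemma entropy_relabel (T U : finType) (f : U -> T) (X : op R T) : bijective f -> psd X ->
  entropy (fun i j => X (f i) (f j)) = entropy X.
Proof.
move=> bf /spectral [V [p h]]; rewrite (entropy_spec h) (entropy_spec (spec_relabel bf h)).
by rewrite [RHS](reindex f) //; apply: onW_bij.
Qed.

(** * Classical-quantum states as block-diagonal operators *)

Definition cq (X S : finType) (p : X -> R) (s : X -> op R S) : op R (X * S)%type :=
  fun u v => if u.1 == v.1 then (p u.1)%:C * s u.1 u.2 v.2 else 0.

Definition bdiag (X S : finType) (Y : X -> op R S) : op R (X * S)%type :=
  fun u v => if u.1 == v.1 then Y u.1 u.2 v.2 else 0.

Lemma bdiagM (X S : finType) (Y Z : X -> op R S) :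
  bdiag Y ** bdiag Z = bdiag (fun x => Y x ** Z x).
Proof.
apply: kernP => -[x a] [y b]; rewrite kmul_pair /bdiag /=.
rewrite (@sum_only1 _ _ _ x) => [|z zx]; last first.
  by apply: big1 => c _; rewrite /= eq_sym (negbTE zx) mul0r.
rewrite /kmul /= eqxx; case: eqVneq => [->//|_].
by apply: big1 => c _; rewrite mulr0.
Qed.

Lemma bdiag_adj (X S : finType) (Y : X -> op R S) : (bdiag Y)^h = bdiag (fun x => (Y x)^h).
Proof.
apply: kernP => -[x a] [y b]; rewrite /kadj /bdiag /= eq_sym.
by case: eqVneq => [->//|_]; rewrite conjC0.
Qed.

Lemma bdiag1 (X S : finType) : bdiag (fun _ : X => @idop R S) = @idop R _.
Proof.
by apply: kernP => -[x a] [y b]; rewrite /bdiag /idop xpair_eqE /=; case: eqVneq.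
Qed.

Lemma spec_cq (X S : finType) (p : X -> R) (s V : X -> op R S) (l : X -> S -> R) :
  (forall x, 0 <= p x) -> (forall x, spec (s x) (V x) (l x)) ->
  spec (cq p s) (bdiag V) (fun u => p u.1 * l u.1 u.2).
Proof.
move=> p0 hs; split.
- split; rewrite bdiag_adj bdiagM -bdiag1; congr bdiag; apply/funext => x.
    by have [[-> _] _ _] := hs x.
  by have [[_ ->] _ _] := hs x.
- by move=> u; have [_ h _] := hs u.1; rewrite mulr_ge0.
- have -> : dg (fun u : X * S => p u.1 * l u.1 u.2) = bdiag (fun x => dg (fun a => p x * l x a)).
    by apply: kernP => -[x a] [y b]; rewrite /dg /bdiag xpair_eqE /=; case: eqVneq.
  rewrite bdiag_adj !bdiagM; apply: kernP => u v; rewrite /cq /bdiag; case: eqP => // _.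
  have [_ _ {1}->] := hs u.1.
  rewrite /kmul big_distrr /=; apply: eq_bigr => j _; rewrite mulrA; congr (_ * _).
  rewrite big_distrr /=; apply: eq_bigr => k _; rewrite mulrCA /dg; congr (_ * _).
  by rewrite rmorphM mulrnAr.
Qed.

Lemma eta_mul (x y : R) : 0 <= x -> 0 <= y -> eta (x * y) = y * eta x + x * eta y.
Proof.
rewrite !le0r => /orP[/eqP ->|x0]; first by rewrite !(mul0r, eta0, mulr0, addr0).
move=> /orP[/eqP ->|y0]; first by rewrite !(mul0r, eta0, mulr0, addr0).
by rewrite /eta /log2 lnM ?posrE //; ring.
Qed.

Lemma spec_sum (T : finType) (X V : op R T) p : spec X V p -> tr X = (\sum_i p i)%:C.
Proof.
move=> [[_ uV] _ ->]; rewrite tr_kmulC kmulA uV kmul1k /tr rmorph_sum /=.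
by apply: eq_bigr => i _; rewrite /dg eqxx.
Qed.

(** The eigenvalues are the products of [p x] with those of [s x]; [eta_mul] splits each term, and
    the eigenvalues of each [s x] sum to 1. *)
Lemma entropy_cq (X S : finType) (p : X -> R) (s : X -> op R S) :
  (forall x, 0 <= p x) -> (forall x, density (s x)) ->
  entropy (cq p s) = \sum_x eta (p x) + \sum_x p x * entropy (s x).
Proof.
move=> p0 hs.
have /choice [V /choice [l hV]] : forall x, exists V l, spec (s x) V l.
  by move=> x; apply: spectral; case: (hs x).
rewrite (entropy_spec (spec_cq p0 hV)) -(pair_bigA _ (fun x a => eta (p x * l x a))) /=.
rewrite -big_split /=; apply: eq_bigr => x _.
rewrite (entropy_spec (hV x)) big_distrr /=.
have [_ l0 _] := hV x.
under eq_bigr => a _ do rewrite eta_mul //.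
rewrite big_split -big_distrl /=; congr (_ + _).
have [_ t1] := hs x; have := spec_sum (hV x); rewrite t1 => /(congr1 (@complex.Re R)) /= <-.
by rewrite mul1r.
Qed.

End Spectral.

(** * Monotonicity of the relative entropy *)

Section RelativeEntropy.
Variable R : realType.
Local Notation C := R[i].

Lemma conjCr (x : R) : (x%:C)^* = x%:C.
Proof. exact: conjc_real. Qed.

Lemma kmulK (T U W : finType) (X : kern R W T) (A : kern R T U) (B : kern R U T) :
  A ** B = @idop R T -> X ** A ** B = X.
Proof. by move=> h; rewrite -kmulA h kmulk1. Qed.

(** The functional whose supremum over [Y] is Psi_s; for Hermitian [rho] the first two traces add up
    to 2 Re tr(rho Y). *)
Definition qform (T : finType) (s : R) (rho sigma Y : op R T) : C :=
  tr (rho ** Y) + tr (rho ** Y^h)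
  - s%:C * tr (sigma ** (Y ** Y^h)) - (1 - s)%:C * tr (rho ** (Y^h ** Y)).

(** Duality preserves the linear terms. The quadratic terms only shrink under pullback: this is the
    Schwarz inequality for [Y] with [rho] and for [Y^h] with [sigma]. *)
Lemma qform_mono (T U : finType) (N : op R T -> op R U) s rho sigma (Y : op R U) :
  channel N -> psd rho -> psd sigma -> 0 <= s <= 1 ->
  qform s (N rho) (N sigma) Y <= qform s rho sigma (chadj N Y).
Proof.
move=> hN hr hs /andP[s0 s1]; rewrite /qform !(tr_chadj hN) (chadj_adj hN).
have h1 := channel_schwarz hN Y hr.
have h2 := channel_schwarz hN (Y^h) hs.
move: h2; rewrite (chadj_adj hN) !kadjK => h2.
rewrite -(tr_chadj hN sigma) -(tr_chadj hN rho (Y^h ** Y)).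
apply: lerB; last by rewrite ler_wpM2l // ler0c subr_ge0.
by apply: lerB => //; rewrite ler_wpM2l // ler0c.
Qed.

(** The transition probability between the i-th column of [V] and the j-th column of [U]. *)
Definition overlap (T : finType) (V U : op R T) (j i : T) : R :=
  complex.Re ((U^h ** V) j i * ((U^h ** V) j i)^*).

Lemma overlapE (T : finType) (V U : op R T) j i :
  (overlap V U j i)%:C = (U^h ** V) j i * ((U^h ** V) j i)^*.
Proof. by apply: RRe_real; apply: ger0_real; apply: mul_conjC_ge0. Qed.

Lemma overlap_ge0 (T : finType) (V U : op R T) j i : 0 <= overlap V U j i.
Proof. by have := mul_conjC_ge0 ((U^h ** V) j i); rewrite -overlapE ler0c. Qed.

Lemma overlap_sum (T : finType) (V U : op R T) i : unitary V -> unitary U ->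
  \sum_j overlap V U j i = 1.
Proof.
move=> [_ V2] [U1 _]; apply: (@complexI R); rewrite rmorph_sum /=.
transitivity (((U^h ** V)^h ** (U^h ** V)) i i).
  by apply: eq_bigr => j _; rewrite overlapE mulrC.
by rewrite kadjM kadjK !kmulA (kmulK _ U1) V2 /idop eqxx.
Qed.

Lemma diag_overlap (T : finType) (rho V U : op R T) p j : spec rho V p ->
  (U^h ** rho ** U) j j = (\sum_i p i * overlap V U j i)%:C.
Proof.
move=> [_ _ ->]; rewrite rmorph_sum /=.
have -> : U^h ** (V ** dg p ** V^h) ** U = (U^h ** V) ** dg p ** (U^h ** V)^h.
  by rewrite kadjM kadjK !kmulA.
rewrite [LHS]/kmul; apply: eq_bigr => i _; rewrite rmorphM /= overlapE.
rewrite {1}/kmul (@sum_only1 _ _ _ i) => [|k ki]; last by rewrite /dg (negbTE ki) mulr0.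
by rewrite /dg eqxx /kadj mulr1n mulrAC mulrC.
Qed.

(** Writing [Y] with rows in the eigenbasis of [sigma] and columns in that of [rho] decouples the
    form into one scalar quadratic per pair (j, i). *)
Lemma qform_expand (T : finType) s (rho sigma Y V U : op R T) p q :
  spec rho V p -> spec sigma U q ->
  let c := U^h ** V in let y := U^h ** Y ** V in
  qform s rho sigma Y = \sum_j \sum_i ((p i)%:C * ((c j i)^* * y j i) + (p i)%:C * (c j i * (y j i)^*)
     - (s * q j + (1 - s) * p i)%:C * (y j i * (y j i)^*)).
Proof.
move=> [[V1 V2] _ er] [[U1 U2] _ es] c y.
have eY : Y = U ** y ** V^h.
  by rewrite /y !kmulA U1 kmul1k (kmulK _ V1).
have eYh : Y^h = V ** y^h ** U^h by rewrite {1}eY !kadjM kadjK kmulA.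
have trV (Z : op R T) : tr (rho ** (V ** Z ** V^h)) = tr (dg p ** Z).
  by rewrite er tr_kmulC !kmulA (kmulK _ V2) tr_kmulC !kmulA V2 kmul1k tr_kmulC.
have trU (Z : op R T) : tr (sigma ** (U ** Z ** U^h)) = tr (dg q ** Z).
  by rewrite es tr_kmulC !kmulA (kmulK _ U2) tr_kmulC !kmulA U2 kmul1k tr_kmulC.
have e1 : Y = V ** (c^h ** y) ** V^h.
  by rewrite eY /c kadjM kadjK !kmulA V1 kmul1k.
have e2 : Y^h = V ** (y^h ** c) ** V^h.
  by rewrite eYh /c !kmulA (kmulK _ V1).
have e3 : Y ** Y^h = U ** (y ** y^h) ** U^h.
  by rewrite {1}eY eYh !kmulA (kmulK _ V2).
have e4 : Y^h ** Y = V ** (y^h ** y) ** V^h.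
  by rewrite eYh {1}eY !kmulA (kmulK _ U2).
rewrite /qform e3 e4 trU trV e2 {1}e1 !trV !tr_dgM /kmul.
have ds (l : T -> C) (F : T -> T -> C) :
    \sum_i l i * (\sum_j F i j) = \sum_j \sum_i l i * F i j.
  by rewrite exchange_big /=; apply: eq_bigr => i _; rewrite mulr_sumr.
have sq : \sum_i (q i)%:C * (\sum_j y i j * y^h j i) =
    \sum_j \sum_i (q j)%:C * (y j i * y^h i j).
  by apply: eq_bigr => j _; rewrite mulr_sumr.
rewrite sq !ds !mulr_sumr -!sumrN -!big_split /=; apply: eq_bigr => j _.
rewrite !mulr_sumr -!sumrN -!big_split /=; apply: eq_bigr => i _.
have -> : (s * q j + (1 - s) * p i)%:C = s%:C * (q j)%:C + (1 - s)%:C * (p i)%:C.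
  by rewrite rmorphD /= !rmorphM.
by rewrite /kadj; ring.
Qed.

(** The sum of the maxima of the scalar quadratics in [qform_expand]; a vanishing denominator
    contributes 0. *)
Definition Psi (T : finType) (s : R) (V U : op R T) (p q : T -> R) : R :=
  \sum_j \sum_i (p i ^+ 2 * overlap V U j i / (s * q j + (1 - s) * p i)).

(** The inclusion of the support of rho in that of sigma, in eigenbasis coordinates; it rules out
    infinite relative entropy. *)
Definition dominated (T : finType) (V U : op R T) (p q : T -> R) : Prop :=
  forall j i, q j = 0 -> p i * overlap V U j i = 0.

(** Complete the square in each entry [y j i]. *)
Lemma qform_le_Psi (T : finType) s (rho sigma Y V U : op R T) p q :
  spec rho V p -> spec sigma U q -> dominated V U p q -> 0 < s <= 1 ->
  qform s rho sigma Y <= (Psi s V U p q)%:C.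
Proof.
move=> hr hs hd /andP[s0 s1]; rewrite (qform_expand _ _ hr hs) /Psi.
have [_ p0 _] := hr; have [_ q0 _] := hs.
rewrite rmorph_sum /=; apply: ler_sum => j _; rewrite rmorph_sum /=; apply: ler_sum => i _.
set c := (U^h ** V) j i; set y := (U^h ** Y ** V) j i.
set xi := s * q j + (1 - s) * p i.
have := overlapE V U j i; rewrite -/c => ew.
have xi0 : 0 <= xi by rewrite addr_ge0 // mulr_ge0 ?p0 ?q0 ?subr_ge0 // ltW.
(* If xi = 0 then [q j = 0] because s > 0, and domination kills the linear terms, so both sides are
   0. *)
have [x0|xn] := eqVneq xi 0.
  have qj : q j = 0.
    have /eqP := x0; rewrite paddr_eq0 ?mulr_ge0 ?p0 ?q0 ?subr_ge0 ?(ltW s0) //.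
    by rewrite mulf_eq0 gt_eqF //= => /andP[/eqP].
  have pc : (p i)%:C * c = 0.
    have h : (p i)%:C * (c * c^*) = 0 by rewrite -ew -rmorphM /= hd.
    have : (p i)%:C * c * ((p i)%:C * c)^* = 0.
      by rewrite rmorphM /= conjCr mulrACA -mulrA h mulr0.
    by move/eqP; rewrite mul_conjC_eq0 => /eqP.
  have pc' : (p i)%:C * c^* = 0.
    by have := congr1 Num.conj pc; rewrite rmorphM conjC0 /= conjCr.
  by rewrite x0 !mulrA pc pc' !mul0r !addr0 subr0 invr0 mulr0.
have xip : 0 < xi by rewrite lt0r xn.
rewrite -subr_ge0 rmorphM /= fmorphV rmorphM rmorphXn /= ew.
have xC : xi%:C != 0 by rewrite -(rmorph0 (real_complex R)) (inj_eq (@complexI R)).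
have -> : (p i)%:C ^+ 2 * (c * c^*) / xi%:C -
   ((p i)%:C * (c^* * y) + (p i)%:C * (c * y^*) - xi%:C * (y * y^*)) =
   (xi%:C)^-1 * (((p i)%:C * c - xi%:C * y) * ((p i)%:C * c - xi%:C * y)^*).
  by rewrite rmorphB !rmorphM /= !conjCr; field.
by rewrite mulr_ge0 ?mul_conjC_ge0 // invr_ge0 ler0c ltW.
Qed.

(** The stationary point of each scalar quadratic is y = p c / xi; where xi = 0 the division yields
    y = 0 and both sides vanish. *)
Lemma Psi_attained (T : finType) s (rho sigma V U : op R T) p q :
  spec rho V p -> spec sigma U q ->
  exists Y, qform s rho sigma Y = (Psi s V U p q)%:C.
Proof.
move=> hr hs; have [[V1 V2] _ _] := hr; have [[U1 U2] _ _] := hs.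
pose y : op R T := fun j i => (p i / (s * q j + (1 - s) * p i))%:C * (U^h ** V) j i.
exists (U ** y ** V^h); rewrite (qform_expand _ _ hr hs) /Psi rmorph_sum /=.
have -> : U^h ** (U ** y ** V^h) ** V = y.
  by rewrite !kmulA U2 kmul1k (kmulK _ V2).
apply: eq_bigr => j _; rewrite rmorph_sum /=; apply: eq_bigr => i _.
have := overlapE V U j i; rewrite /y; set c := (U^h ** V) j i => ew.
set xi := s * q j + (1 - s) * p i.
rewrite !rmorphM /= !conjCr !fmorphV ew /=.
have [->|xn] := eqVneq xi 0; first by rewrite rmorph0 invr0 !(mulr0, mul0r) addr0 subr0.
have xC : xi%:C != 0 by rewrite -(rmorph0 (real_complex R)) (inj_eq (@complexI R)).
by field.
Qed.

Lemma spec_psd (T : finType) (X V : op R T) l : spec X V l -> psd X.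
Proof.
move=> [_ l0 ->]; apply: psd_conj => v.
have -> : \sum_i \sum_j (v i)^* * dg l i j * v j = \sum_i (l i)%:C * (v i * (v i)^*).
  apply: eq_bigr => i _; rewrite (@sum_only1 _ _ _ i) => [|k ki].
    by rewrite /dg eqxx mulr1n; ring.
  by rewrite /dg eq_sym (negbTE ki) mulr0 mul0r.
by apply: sumr_ge0 => i _; rewrite mulr_ge0 ?mul_conjC_ge0 // ler0c.
Qed.

(** Take the optimal [Y] at the output and pull it back through [chadj]: the result competes in the
    supremum at the input. *)
Lemma Psi_mono (T T' : finType) (N : op R T -> op R T') s (rho sigma V U : op R T)
  (V' U' : op R T') p q p' q' : channel N ->
  spec rho V p -> spec sigma U q -> dominated V U p q ->
  spec (N rho) V' p' -> spec (N sigma) U' q' -> 0 < s <= 1 ->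
  Psi s V' U' p' q' <= Psi s V U p q.
Proof.
move=> hN hr hs hd hr' hs' s01; have [Y eY] := Psi_attained s hr' hs'.
rewrite -lecR -eY; apply: le_trans (qform_le_Psi _ hr hs hd s01).
case/andP: s01 => s0 s1.
by apply: qform_mono; rewrite ?(ltW s0) //; [apply: spec_psd hr|apply: spec_psd hs].
Qed.

End RelativeEntropy.

(** * Riemann sums for the logarithm and passage to the limit *)

Section RelentMono.
Variable R : realType.
Local Notation C := R[i].

Definition lnsum (x : R) (n : nat) : R :=
  \sum_(k < n.+1) ((x - 1) / n.+1%:R) / (1 + k.+1%:R / n.+1%:R * (x - 1)).

(* Right Riemann sum of [ln x = int_0^1 (x - 1) / (1 + s (x - 1)) ds]; the integrand is monotone in [s],
   so the error is at most [1/n] times its variation. *)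
Lemma ln_riemann (x : R) (n : nat) : 0 < x ->
  lnsum x n <= ln x <= lnsum x n + (x - 1) ^+ 2 / x / n.+1%:R.
Proof.
move=> x0; set S := lnsum x n; pose d := (x - 1) / n.+1%:R; pose a (k : nat) := 1 + k%:R / n.+1%:R * (x - 1).
have n0 : (n.+1%:R : R) != 0 by rewrite pnatr_eq0.
have aS k : a k.+1 = a k + d by rewrite /a /d -addn1 natrD; field; rewrite addrC natr1.
have a0 k : (k <= n.+1)%N -> 0 < a k.
  move=> kn; have -> : a k = (1 - k%:R / n.+1%:R) + k%:R / n.+1%:R * x by rewrite /a; ring.
  have h0 : 0 <= k%:R / n.+1%:R :> R by rewrite divr_ge0.
  have h1 : k%:R / n.+1%:R <= 1 :> R by rewrite ler_pdivrMr ?ltr0n // mul1r ler_nat.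
  have [e|h] := eqVneq (k%:R / n.+1%:R : R) 0; first by rewrite e mul0r subr0 addr0.
  by rewrite ltr_wpDl ?subr_ge0 // mulr_gt0 // lt0r h.
have aN : a n.+1 = x by rewrite /a divff // mul1r addrCA subrr addr0.
have a00 : a 0%N = 1 by rewrite /a mul0r mul0r addr0.
have tele (f : R -> R) : f x - f 1 = \sum_(k < n.+1) (f (a k.+1) - f (a k)).
  by rewrite -(big_mkord xpredT (fun k => f (a k.+1) - f (a k))) telescope_sumr // aN a00.
have SE : S = \sum_(k < n.+1) d / a k.+1 by [].
have lnE : ln x = \sum_(k < n.+1) (ln (a k.+1) - ln (a k)) by rewrite -tele ln1 subr0.
(* Both bounds come from ln(1 + t) <= t, applied to the ratio of neighbouring nodes and to its
   inverse. *)
have step k : (k < n.+1)%N -> d / a k.+1 <= ln (a k.+1) - ln (a k) <= d / a k.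
  move=> kn; have h1 := a0 _ kn; have h2 := a0 _ (ltnW kn); apply/andP; split.
    have e : a k / a k.+1 = 1 + (- (d / a k.+1)).
      by rewrite -[a k](addrK d) -aS; field; rewrite gt_eqF.
    rewrite -lerN2 opprB -ln_div ?posrE // e; apply: le_ln1Dx.
    by rewrite -subr_gt0 opprK addrC -e divr_gt0.
  have e : a k.+1 / a k = 1 + d / a k by rewrite aS; field; rewrite gt_eqF.
  rewrite -ln_div ?posrE // e; apply: le_ln1Dx.
  by rewrite -subr_gt0 opprK addrC -e divr_gt0.
apply/andP; split; first by rewrite SE lnE; apply: ler_sum => k _; case/andP: (step k (ltn_ord k)).
(* The upper bound is the left Riemann sum; its difference from the right one telescopes to d - d /
   x. *)
have -> : S + (x - 1) ^+ 2 / x / n.+1%:R = \sum_(k < n.+1) d / a k.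
  have h := tele (fun y => d / y); rewrite sumrB -SE /= in h.
  have -> : \sum_(k < n.+1) d / a k = S - (d / x - d / 1) by rewrite h; ring.
  by rewrite /d; field; rewrite (gt_eqF x0) [1 + _]addrC natr1 n0.
by rewrite lnE; apply: ler_sum => k _; case/andP: (step k (ltn_ord k)).
Qed.

(** Right endpoints, so that no node is 0 and dividing by a node is harmless. *)
Definition rnode (n k : nat) : R := k.+1%:R / n.+1%:R.

Lemma rnode_bound n k : (k < n.+1)%N -> 0 < rnode n k <= 1.
Proof.
by move=> kn; rewrite divr_gt0 ?ltr0n //= ler_pdivrMr ?ltr0n // mul1r ler_nat.
Qed.

(** The Riemann sum for - p ln(q / p), using p (p - q) / xi = (p^2 / xi - p) / s with xi = s q + (1
    - s) p, so that the summand of [Psi] appears. *)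
Definition rsum (n : nat) (p q : R) : R :=
  n.+1%:R^-1 * \sum_(k < n.+1) (rnode n k)^-1 *
     (p ^+ 2 / (rnode n k * q + (1 - rnode n k) * p) - p).

Lemma rsum_bound n (p q : R) : 0 < p -> 0 < q ->
  p * (ln p - ln q) <= rsum n p q <= p * (ln p - ln q) + (p - q) ^+ 2 / q / n.+1%:R.
Proof.
move=> p0 q0; have := ln_riemann n (divr_gt0 q0 p0).
set S := lnsum _ _ => /andP[h1 h2].
have n0 : (n.+1%:R : R) != 0 by rewrite pnatr_eq0.
have -> : rsum n p q = - (p * S).
  rewrite /rsum /S /lnsum !mulr_sumr -sumrN; apply: eq_bigr => k _.
  have /andP[s0 s1] := rnode_bound (ltn_ord k); rewrite -/(rnode n k).
  set s := rnode n k in s0 s1 *.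
  have D0 : 0 < s * q + (1 - s) * p.
    by rewrite ltr_pwDl ?mulr_gt0 // mulr_ge0 ?subr_ge0 // ltW.
  have -> : 1 + s * (q / p - 1) = (s * q + (1 - s) * p) / p by field; rewrite gt_eqF.
  move: n0; move: (n.+1%:R : R) => m m0.
  by field; rewrite m0 !gt_eqF.
move: h1 h2; rewrite ln_div ?posrE // => h1 h2.
have e : (p - q) ^+ 2 / q / n.+1%:R = p * ((q / p - 1) ^+ 2 / (q / p) / n.+1%:R).
  by move: n0; move: (n.+1%:R : R) => m m0; field; rewrite m0 !gt_eqF.
rewrite e; set z := _ / n.+1%:R in h2 *.
have -> : p * (ln p - ln q) = - (p * (ln q - ln p)) by ring.
rewrite lerN2 ler_pM2l // h1 -subr_ge0 /=.
have -> : - (p * (ln q - ln p)) + p * z - - (p * S) = p * (S + z - (ln q - ln p)) by ring.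
by rewrite mulr_ge0 ?(ltW p0) // subr_ge0.
Qed.

(** The Umegaki relative entropy in nats, in eigenbases [V] of rho and [U] of sigma; it has this
    meaning under [dominated]. *)
Definition relent (T : finType) (V U : op R T) (p q : T -> R) : R :=
  \sum_j \sum_i overlap V U j i * (p i * (ln (p i) - ln (q j))).

Definition relent_rsum (T : finType) n (V U : op R T) (p q : T -> R) : R :=
  \sum_j \sum_i overlap V U j i * rsum n (p i) (q j).

(** This exhibits the approximation as a positive combination of the monotone quantities Psi_s minus
    the trace. *)
Lemma relent_rsumE (T : finType) n (V U : op R T) (p q : T -> R) :
  unitary V -> unitary U ->
  relent_rsum n V U p q =
  n.+1%:R^-1 * \sum_(k < n.+1) (rnode n k)^-1 * (Psi (rnode n k) V U p q - \sum_i p i).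
Proof.
move=> uV uU; have -> : \sum_i p i = \sum_j \sum_i overlap V U j i * p i.
  rewrite exchange_big /=; apply: eq_bigr => i _.
  by rewrite -mulr_suml overlap_sum // mul1r.
rewrite /relent_rsum /rsum /Psi.
under eq_bigr => j _ do under eq_bigr => i _ do rewrite mulrCA mulr_sumr.
under eq_bigr => j _ do rewrite -mulr_sumr exchange_big /=.
rewrite -mulr_sumr exchange_big /=; congr (_ * _); apply: eq_bigr => k _.
rewrite -sumrB mulr_sumr; apply: eq_bigr => j _.
rewrite -sumrB mulr_sumr; apply: eq_bigr => i _; ring.
Qed.

(** Termwise [rsum_bound]. A term with [p i = 0] vanishes, and one with [q j = 0] has zero overlap
    or zero [p i] by domination. The error constant does not depend on [n]. *)
Lemma relent_rsum_bound (T : finType) n (V U : op R T) (p q : T -> R) :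
  (forall i, 0 <= p i) -> (forall i, 0 <= q i) -> dominated V U p q ->
  relent V U p q <= relent_rsum n V U p q <=
  relent V U p q + (\sum_j \sum_i overlap V U j i * ((p i - q j) ^+ 2 / q j)) / n.+1%:R.
Proof.
move=> p0 q0 hd.
have key j i : overlap V U j i * (p i * (ln (p i) - ln (q j))) <=
    overlap V U j i * rsum n (p i) (q j) <=
    overlap V U j i * (p i * (ln (p i) - ln (q j))) +
    overlap V U j i * ((p i - q j) ^+ 2 / q j) / n.+1%:R.
  have w0 := overlap_ge0 V U j i.
  have K0 : 0 <= overlap V U j i * ((p i - q j) ^+ 2 / q j) / n.+1%:R.
    by rewrite divr_ge0 // mulr_ge0 // divr_ge0 // sqr_ge0.
  have [e|pn] := eqVneq (p i) 0.
    have -> : rsum n (p i) (q j) = 0.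
      by rewrite /rsum big1 ?mulr0 // => k _; rewrite e expr0n mul0r subr0 mulr0.
    have -> : p i * (ln (p i) - ln (q j)) = 0 by rewrite e mul0r.
    by rewrite mulr0 lexx add0r.
  have pp : 0 < p i by rewrite lt0r pn p0.
  have [e|qn] := eqVneq (q j) 0.
    have /eqP := hd j i e; rewrite mulf_eq0 (negbTE pn) /= => /eqP w.
    by rewrite w !mul0r addr0 lexx.
  have qp : 0 < q j by rewrite lt0r qn q0.
  have /andP[h1 h2] := rsum_bound n pp qp.
  by rewrite -[_ / n.+1%:R]mulrA -mulrDr !ler_wpM2l.
rewrite /relent /relent_rsum mulr_suml -big_split /=; apply/andP; split.
  by apply: ler_sum => j _; apply: ler_sum => i _; case/andP: (key j i).
apply: ler_sum => j _; rewrite mulr_suml -big_split /=.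
by apply: ler_sum => i _; case/andP: (key j i).
Qed.

Lemma le_of_harmonic (x y K : R) : (forall n : nat, x <= y + K / n.+1%:R) -> x <= y.
Proof.
move=> h; rewrite leNgt; apply/negP => yx.
have d0 : 0 < x - y by rewrite subr_gt0.
pose n := Num.truncn (`|K| / (x - y)).
have := h n; rewrite -lerBlDl leNgt => /negP; apply.
have hn : `|K| / (x - y) < n.+1%:R by apply: truncnS_gt.
rewrite ltr_pdivrMr ?ltr0n //; apply: le_lt_trans (ler_norm K) _.
by rewrite mulrC -ltr_pdivrMr.
Qed.

(** For each [n], bound the output below its Riemann sum and the input above its own. The sums
    compare node by node, the traces being equal, and the remaining error is O(1/n). *)
Lemma relent_mono (T T' : finType) (N : op R T -> op R T') (rho sigma V U : op R T)
  (V' U' : op R T') p q p' q' : channel N ->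
  spec rho V p -> spec sigma U q -> dominated V U p q ->
  spec (N rho) V' p' -> spec (N sigma) U' q' -> dominated V' U' p' q' ->
  relent V' U' p' q' <= relent V U p q.
Proof.
move=> hN hr hs hd hr' hs' hd'.
have [uV p0 _] := hr; have [uU q0 _] := hs.
have [uV' p0' _] := hr'; have [uU' q0' _] := hs'.
have et : \sum_i p' i = \sum_i p i.
  apply: (@complexI R); rewrite -(spec_sum hr) -(spec_sum hr').
  by case: hN => _ _ ->.
apply: le_of_harmonic => n.
have /andP[h1 _] := relent_rsum_bound n p0' q0' hd'.
have /andP[_ h2] := relent_rsum_bound n p0 q0 hd.
apply: le_trans h1 (le_trans _ h2).
rewrite !relent_rsumE // et ler_wpM2l ?invr_ge0 //.
apply: ler_sum => k _; have sk := rnode_bound (ltn_ord k).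
rewrite ler_wpM2l ?invr_ge0 //; first by case/andP: sk => /ltW.
by rewrite lerB // (Psi_mono hN hr hs hd hr' hs').
Qed.

(** * Holevo quantities *)

(** The Holevo quantity is the mean relative entropy to the average state. The weights are not
    normalised, so that it applies to the messages sharing one letter, possibly of total weight
    0. *)
Lemma holevo_relent (I T : finType) (w : I -> R) (rho V : I -> op R T) (sigma U : op R T)
  (p : I -> T -> R) (q : T -> R) : (forall i, 0 <= w i) ->
  (forall i, spec (rho i) (V i) (p i)) -> spec sigma U q ->
  (forall a b, (\sum_i w i)%:C * sigma a b = \sum_i (w i)%:C * rho i a b) ->
  (forall i, w i != 0 -> dominated (V i) U (p i) q) /\
  \sum_i w i * relent (V i) U (p i) q =
    ln 2 * ((\sum_i w i) * entropy sigma - \sum_i w i * entropy (rho i)).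
Proof.
move=> w0 hr hs hav; set W := \sum_i w i.
(* Diagonal entries of the averaging identity in the eigenbasis of [sigma]. *)
have qd j : W * q j = \sum_i w i * \sum_k p i k * overlap (V i) U j k.
  apply: (@complexI R); rewrite rmorphM [RHS]rmorph_sum /=.
  have <- : (U^h ** sigma ** U) j j = (q j)%:C.
    by rewrite (unitary_diag (p:=q)) ?/dg ?eqxx //; case: hs.
  under [RHS]eq_bigr => i _ do rewrite rmorphM /= -(diag_overlap _ _ (hr i)).
  rewrite /kmul mulr_sumr; under [RHS]eq_bigr => i _ do rewrite mulr_sumr.
  rewrite [RHS]exchange_big /=; apply: eq_bigr => b _.
  rewrite mulrA mulr_sumr; under [RHS]eq_bigr => i _ do rewrite mulrA mulr_sumr.
  rewrite -mulr_suml; congr (_ * _); rewrite [RHS]exchange_big /=.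
  apply: eq_bigr => a _; rewrite mulrCA hav mulr_sumr; apply: eq_bigr => i _.
  by rewrite mulrCA.
split.
  (* When [q j = 0], [qd] is a vanishing sum of nonnegative terms, so every term of nonzero weight
     vanishes. *)
  move=> i wi j k qj; have := qd j; rewrite qj mulr0 => /esym /eqP.
  have nn i' : 0 <= \sum_k p i' k * overlap (V i') U j k.
    by have [_ h _] := hr i'; apply: sumr_ge0 => l _; rewrite mulr_ge0 ?overlap_ge0.
  rewrite psumr_eq0 => [|i' _]; last by rewrite mulr_ge0.
  move=> /allP /(_ i); rewrite mem_index_enum mulf_eq0 (negbTE wi) /= => /(_ isT) /eqP /eqP.
  rewrite psumr_eq0 => [|l _]; last by have [_ h _] := hr i; rewrite mulr_ge0 ?overlap_ge0.
  by move=> /allP /(_ k); rewrite mem_index_enum => /(_ isT) /eqP.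
have l2 : ln 2 != 0 :> R by rewrite gt_eqF // ln_gt0 // ltr1n.
have etaE x : ln 2 * eta x = - (x * ln x) :> R by rewrite /eta /log2; field.
rewrite (entropy_spec hs) mulrBr.
have -> : ln 2 * (W * \sum_i eta (q i)) = - \sum_j W * q j * ln (q j).
  rewrite mulrCA !mulr_sumr -sumrN; apply: eq_bigr => j _.
  by rewrite etaE; ring.
have -> : ln 2 * (\sum_i w i * entropy (rho i)) = - \sum_i w i * \sum_k p i k * ln (p i k).
  rewrite mulr_sumr -sumrN; apply: eq_bigr => i _; rewrite (entropy_spec (hr i)).
  rewrite mulrCA -mulrN; congr (_ * _); rewrite mulr_sumr -sumrN.
  by apply: eq_bigr => k _.
rewrite opprK addrC.
under [X in _ = _ - X]eq_bigr => j _ do rewrite qd mulr_suml.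
rewrite exchange_big /= -sumrB; apply: eq_bigr => i _.
under [X in _ = _ - X]eq_bigr => j _ do rewrite -mulrA.
rewrite -mulr_sumr -mulrBr; congr (_ * _); rewrite /relent.
have [uV _ _] := hr i; have [uU _ _] := hs.
have -> : \sum_k p i k * ln (p i k) = \sum_j \sum_k overlap (V i) U j k * (p i k * ln (p i k)).
  rewrite exchange_big /=; apply: eq_bigr => k _.
  by rewrite -mulr_suml overlap_sum // mul1r.
rewrite -sumrB; apply: eq_bigr => j _; rewrite mulr_suml -sumrB; apply: eq_bigr => k _.
by ring.
Qed.

Lemma holevo_mono (I T T' : finType) (N : op R T -> op R T') (w : I -> R) (rho : I -> op R T)
  (sigma : op R T) : channel N -> (forall i, 0 <= w i) ->
  (forall i, psd (rho i)) -> psd sigma ->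
  (forall a b, (\sum_i w i)%:C * sigma a b = \sum_i (w i)%:C * rho i a b) ->
  (\sum_i w i) * entropy (N sigma) - \sum_i w i * entropy (N (rho i)) <=
  (\sum_i w i) * entropy sigma - \sum_i w i * entropy (rho i).
Proof.
move=> hN w0 hr hs hav.
have /choice [V /choice [p hV]] : forall i, exists V p, spec (rho i) V p.
  by move=> i; apply: spectral.
have /choice [V' /choice [p' hV']] : forall i, exists V p, spec (N (rho i)) V p.
  by move=> i; apply/spectral/channel_psd.
have [U [q hU]] := spectral hs.
have [U' [q' hU']] := spectral (channel_psd hN hs).
have Nl : oplinear N by case: hN.
have hav' a b : (\sum_i w i)%:C * N sigma a b = \sum_i (w i)%:C * N (rho i) a b.
  have /(congr1 (fun f => N f a b)) : (fun i j => (\sum_i w i)%:C * sigma i j) =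
     (fun i j => \sum_k (w k)%:C * rho k i j) by apply: kernP.
  by rewrite oplinearZ // oplinear_sum.
have [d e] := holevo_relent w0 hV hU hav.
have [d' e'] := holevo_relent w0 hV' hU' hav'.
have l2 : 0 < ln 2 :> R by rewrite ln_gt0 // ltr1n.
rewrite -(ler_pM2l l2) -e -e'; apply: ler_sum => i _.
have [->|wi] := eqVneq (w i) 0; first by rewrite !mul0r.
rewrite ler_wpM2l //.
exact: (relent_mono hN (hV i) hU (d i wi) (hV' i) hU' (d' i wi)).
Qed.

End RelentMono.

(** * Gain of the Holevo quantity in one call of the cell *)

Section Holevo.
Variable R : realType.
Local Notation C := R[i].

Lemma tr_pair (E T : finType) (X : op R (E * T)%type) :
  tr X = \sum_e \sum_a X (e, a) (e, a).
Proof. by rewrite pair_bigA; apply: eq_bigr => -[]. Qed.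

Lemma channel_id_tens (E T U : finType) (N : op R T -> op R U) :
  channel N -> channel (id_tens (E:=E) N).
Proof.
move=> [hl hc ht]; split.
- by move=> c X Y; apply: kernP => p q; rewrite /id_tens hl.
- move=> E' X hX.
  have /hc := psd_relabel (fun p : (E' * E) * T => (p.1.1, (p.1.2, p.2))) hX.
  by move=> /(psd_relabel (fun p : E' * (E * U) => ((p.1, p.2.1), p.2.2))).
- move=> X; rewrite !tr_pair; apply: eq_bigr => e _; exact: (ht (fun a a' => X (e, a) (e, a'))).
Qed.

Definition avg (I T : finType) (w : I -> R) (rho : I -> op R T) : op R T :=
  fun a b => \sum_i (w i)%:C * rho i a b.

Definition chi (I T : finType) (w : I -> R) (rho : I -> op R T) : R :=
  entropy (avg w rho) - \sum_i w i * entropy (rho i).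

Lemma avg_density (I T : finType) (w : I -> R) (rho : I -> op R T) :
  prob_distr w -> (forall i, density (rho i)) -> density (avg w rho).
Proof.
move=> [w0 w1] h; split.
  by apply: psd_sum => i _ //; case: (h i).
rewrite /tr /avg exchange_big /= -(rmorph1 (real_complex R)) -w1 rmorph_sum /=.
by apply: eq_bigr => i _; rewrite -mulr_sumr; case: (h i) => _; rewrite /tr => ->; rewrite mulr1.
Qed.

Lemma chi_mono (I T T' : finType) (N : op R T -> op R T') (w : I -> R) (rho : I -> op R T) :
  channel N -> prob_distr w -> (forall i, density (rho i)) ->
  chi w (fun i => N (rho i)) <= chi w rho.
Proof.
move=> hN hw hr; have [w0 w1] := hw.
have Nl : oplinear N by case: hN.
have := @holevo_mono R I T T' N w rho (avg w rho) hN w0 (fun i => (hr i).1) (avg_density hw hr).1.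
rewrite w1 !mul1r /chi => h.
have -> : avg w (fun i => N (rho i)) = N (avg w rho) by rewrite [RHS]oplinear_sum.
by apply: h => a b; rewrite mul1r.
Qed.

Lemma chi_const (I T : finType) (w : I -> R) (rho : op R T) :
  prob_distr w -> chi w (fun _ => rho) = 0.
Proof.
move=> [_ w1]; rewrite /chi -mulr_suml w1 mul1r.
have -> : avg w (fun _ => rho) = rho.
  by apply: kernP => a b; rewrite /avg -mulr_suml -rmorph_sum /= w1 mul1r.
by rewrite subrr.
Qed.

Lemma ptr2_density (T U : finType) (X : op R (T * U)%type) : density X -> density (ptr2 X).
Proof.
move=> [h1 h2]; split.
  have := @psd_sum R U T xpredT (fun _ => 1) (fun u t t' => X (t, u) (t', u)) _ _.
  have -> : (fun a b => \sum_i 1%:C * X (a, i) (b, i)) = ptr2 X.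
    by apply: kernP => a b; apply: eq_bigr => u _; rewrite mul1r.
  by apply => // u _; apply: (psd_relabel (fun t => (t, u)) h1).
by rewrite -h2 tr_pair.
Qed.

Lemma cq_psd (X S : finType) (p : X -> R) (s : X -> op R S) :
  (forall x, 0 <= p x) -> (forall x, psd (s x)) -> psd (cq p s).
Proof.
move=> p0 hs.
have /choice [V /choice [l hV]] : forall x, exists V l, spec (s x) V l.
  by move=> x; apply: spectral.
exact: spec_psd (spec_cq p0 hV).
Qed.

(** In H(XE) - H(XEA) the classical entropy of [p] cancels; what is left regroups into two Holevo
    quantities. *)
Lemma cmi_cqstate (X E A : finType) (p : X -> R) (rho : X -> op R (E * A)%type) :
  prob_distr p -> (forall x, density (rho x)) ->
  cmi (cqstate p rho) = chi p rho - chi p (fun x => ptr2 (rho x)).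
Proof.
move=> [p0 p1] hr.
have e1 : ptr2 (cqstate p rho) = cq p (fun x => ptr2 (rho x)).
  apply: kernP => u v; rewrite /ptr2 /cqstate /cq /=.
  by case: eqP => _; [rewrite mulr_sumr | rewrite big1].
have e2 : ptr1_3 (cqstate p rho) = avg p rho.
  apply: kernP => -[e a] [e' a']; rewrite /ptr1_3 /cqstate /avg /=.
  by apply: eq_bigr => x _; rewrite eqxx.
have e3 : ptr1 (cq p (fun x => ptr2 (rho x))) = avg p (fun x => ptr2 (rho x)).
  apply: kernP => e e'; rewrite /ptr1 /cq /avg /=.
  by apply: eq_bigr => x _; rewrite eqxx.
have e4 : entropy (cqstate p rho) = entropy (cq p rho).
  rewrite -(@entropy_relabel R _ _ (fun u : (X * E) * A => (u.1.1, (u.1.2, u.2))) (cq p rho)) //.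
    by exists (fun u => ((u.1, u.2.1), u.2.2)) => [[[]]|[? []]].
  by apply: cq_psd => // x; case: (hr x).
rewrite /cmi e1 e2 e3 e4 !entropy_cq // => [|x]; last exact: ptr2_density.
rewrite /chi; ring.
Qed.

Lemma ptr2_id_tens (E A B : finType) (N : op R A -> op R B) (X : op R (E * A)%type) :
  trace_pres N -> ptr2 (id_tens N X) = ptr2 X.
Proof. by move=> h; apply: kernP => e e'; exact: (h (fun a a' => X (e, a) (e', a'))). Qed.

(** The cell is trace preserving and acts only on A, so the memory marginals, and hence their Holevo
    terms, are unchanged and cancel. *)
Lemma cmi_gain (X E A B : finType) (N : X -> op R A -> op R B) (p : X -> R)
  (rho : X -> op R (E * A)%type) : (forall x, channel (N x)) ->
  prob_distr p -> (forall x, density (rho x)) ->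
  cmi (cqstate p (fun x => id_tens (N x) (rho x))) - cmi (cqstate p rho) =
  chi p (fun x => id_tens (N x) (rho x)) - chi p rho.
Proof.
move=> hN hp hr; rewrite !cmi_cqstate //; last first.
  by move=> x; apply: channel_density => //; apply: channel_id_tens.
have -> : (fun x => ptr2 (id_tens (N x) (rho x))) = fun x => ptr2 (rho x).
  by apply/funext => x; apply: ptr2_id_tens; case: (hN x).
ring.
Qed.

(* Grouping the messages by the letter they use in the current call. *)
Lemma chi_gain_group (M X T U : finType) (N : X -> op R T -> op R U) (w : M -> R) (x : M -> X)
  (rho : M -> op R T) : (forall x, channel (N x)) -> prob_distr w -> (forall m, density (rho m)) ->
  exists (p : X -> R) (r : X -> op R T), [/\ prob_distr p, (forall y, density (r y)) &
    chi w (fun m => N (x m) (rho m)) - chi w rho <= chi p (fun y => N y (r y)) - chi p r].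
Proof.
move=> hN hw hr; have [w0 w1] := hw.
pose wy y m := if x m == y then w m else 0.
have wy0 y m : 0 <= wy y m by rewrite /wy; case: ifP.
have sw (F : X -> M -> R) : \sum_y \sum_m wy y m * F y m = \sum_m w m * F (x m) m.
  rewrite exchange_big /=; apply: eq_bigr => m _.
  rewrite (bigD1 (x m)) //= /wy eqxx big1 ?addr0 // => y yx.
  by rewrite eq_sym (negbTE yx) mul0r.
pose p y := \sum_m wy y m.
(* For a letter of probability 0 any state will do; the overall average serves as default. *)
pose r y := if p y == 0 then avg w rho else fun a b => ((p y)^-1)%:C * avg (wy y) rho a b.
have hp : prob_distr p.
  split; first by move=> y; apply: sumr_ge0.
  have := sw (fun _ _ => 1).
  under eq_bigr => y _ do under eq_bigr => m _ do rewrite mulr1.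
  by under [RHS]eq_bigr => m _ do rewrite mulr1; rewrite w1.
have wr y a b : (p y)%:C * r y a b = avg (wy y) rho a b.
  rewrite /r; case: eqP => [e|/eqP e]; last by rewrite mulrA -rmorphM /= divff // mul1r.
  have z m : wy y m = 0.
    by apply/eqP; move/eqP: e; rewrite psumr_eq0 // => /allP /(_ m); rewrite mem_index_enum => /(_ isT).
  by rewrite e mul0r /avg big1 // => m _; rewrite z mul0r.
have hd y : density (r y).
  have [e|e] := eqVneq (p y) 0; first by rewrite /r e eqxx; apply: avg_density.
  have -> : r y = avg (fun m => (p y)^-1 * wy y m) rho.
    apply: kernP => a b; rewrite /r (negbTE e) /avg mulr_sumr; apply: eq_bigr => m _.
    by rewrite rmorphM mulrA.
  apply: avg_density => //; split; first by move=> m; rewrite mulr_ge0 // invr_ge0 hp.1.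
  by rewrite -mulr_sumr mulVf.
exists p, r; split=> //.
have swC (F : X -> M -> C) : \sum_y \sum_m (wy y m)%:C * F y m = \sum_m (w m)%:C * F (x m) m.
  rewrite exchange_big /=; apply: eq_bigr => m _.
  rewrite (bigD1 (x m)) //= /wy eqxx big1 ?addr0 // => y yx.
  by rewrite eq_sym (negbTE yx) mul0r.
have a1 : avg w rho = avg p r.
  apply: kernP => a b; rewrite [RHS]/avg; under [RHS]eq_bigr => y _ do rewrite wr.
  by rewrite (swC (fun _ m => rho m a b)).
have a2 : avg w (fun m => N (x m) (rho m)) = avg p (fun y => N y (r y)).
  apply: kernP => a b; rewrite [RHS]/avg.
  transitivity (\sum_y \sum_m (wy y m)%:C * N y (rho m) a b).
    by rewrite (swC (fun y m => N y (rho m) a b)).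
  apply: eq_bigr => y _; have Nl : oplinear (N y) by case: (hN y).
  have /(congr1 (fun f => N y f a b)) : (fun i j => (p y)%:C * r y i j) =
     (fun i j => \sum_k (wy y k)%:C * rho k i j) by apply: kernP => i j; rewrite wr.
  by rewrite oplinearZ // oplinear_sum.
(* By [a1] and [a2] the average states agree, so only the entropies of the individual states differ;
   monotonicity under [N y] inside each group compares them. *)
have key y := holevo_mono (hN y) (wy0 y) (fun m => (hr m).1) (hd y).1 (wr y).
rewrite /chi a1 a2 opprB opprB addrACA [leRHS]addrACA !addrA lerD2r -!addrA lerD2l.
rewrite -(sw (fun _ m => entropy (rho m))) -(sw (fun y m => entropy (N y (rho m)))) -!sumrB.
by apply: ler_sum => y _; have := key y; rewrite -/(p y); lra.
Qed.

Lemma chi_gain_bound (X E A B M : finType) (N : X -> op R A -> op R B) (beta : R)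
  (w : M -> R) (x : M -> X) (rho : M -> op R (E * A)%type) : (forall x, channel (N x)) ->
  (forall (E' : finType) (p : X -> R) (r : X -> op R (E' * A)%type), prob_distr p ->
     (forall y, density (r y)) ->
     cmi (cqstate p (fun y => id_tens (N y) (r y))) - cmi (cqstate p r) <= beta) ->
  prob_distr w -> (forall m, density (rho m)) ->
  chi w (fun m => id_tens (N (x m)) (rho m)) <= chi w rho + beta.
Proof.
move=> hN hb hw hr; rewrite -lerBlDl.
have hN' y := @channel_id_tens E _ _ _ (hN y).
have [p [r [hp hd h]]] := chi_gain_group x hN' hw hr.
by apply: le_trans h _; rewrite -cmi_gain //; apply: hb.
Qed.

End Holevo.

(** * Reading protocols *)

Section Reading.
Variable R : realType.
Local Notation C := R[i].

(** Induction on calls, [run k] being the state after k + 1 of them. The initial state does not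
    depend on the message, so [chi] starts at 0; [ad k] does not raise it and each call adds at most
    [beta]. *)
Lemma run_chi (X A B M : finType) (N : X -> op R A -> op R B) (Rs : nat -> finType)
  (rho0 : op R (Rs 0 * A)%type) (ad : forall k, op R (Rs k * B)%type -> op R (Rs k.+1 * A)%type)
  (enc : M -> nat -> X) (w : M -> R) (beta : R) (n : nat) : (forall x, channel (N x)) ->
  (forall (E : finType) (p : X -> R) (r : X -> op R (E * A)%type), prob_distr p ->
     (forall y, density (r y)) ->
     cmi (cqstate p (fun y => id_tens (N y) (r y))) - cmi (cqstate p r) <= beta) ->
  prob_distr w -> density rho0 -> (forall k, (k < n)%N -> channel (ad k)) ->
  forall k, (k <= n)%N -> (forall m, density (run N rho0 ad (enc m) k)) /\
    chi w (fun m => run N rho0 ad (enc m) k) <= k.+1%:R * beta.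
Proof.
move=> hN hb hw h0 had; have hN' (E : finType) y := @channel_id_tens R E _ _ _ (hN y).
elim=> [_|k IH kn].
  split=> [m|/=]; first exact: channel_density.
  have := @chi_gain_bound R X (Rs 0) A B M N beta w (fun m => enc m 0%N) (fun _ => rho0) hN hb hw (fun _ => h0).
  by rewrite chi_const // add0r mul1r.
have [hd hc] := IH (ltnW kn).
have hd' m : density (ad k (run N rho0 ad (enc m) k)) by apply: channel_density; [apply: had | ].
split=> [m|/=]; first exact: channel_density.
apply: le_trans (chi_gain_bound (fun m => enc m k.+1) hN hb hw hd') _.
rewrite -[k.+2%:R]natr1 mulrDl mul1r lerD2r; apply: le_trans hc.
exact: chi_mono (had k kn) hw hd.
Qed.

(** * Measurement and Fano's inequality *)

Definition meas (M T : finType) (L : M -> op R T) (X : op R T) : op R M :=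
  fun i j => if i == j then tr (L i ** X) else 0.

Lemma meas_channel (M T : finType) (L : M -> op R T) : povm L -> channel (meas L).
Proof.
move=> [hL hI]; split.
- move=> c X Y; apply: kernP => i j; rewrite /meas; case: eqP => _.
    by rewrite kmulDr trD.
  by rewrite mulr0 addr0.
- move=> E X hX.
  pose Y i : op R E := fun e f => tr (L i ** (fun a a' => X (e, a) (f, a'))).
  have hY i : psd (Y i).
    have [V [l hV]] := spectral (hL i); have [_ l0 eL] := hV.
    (* [W k] is the identity on [E] tensored with the bra of the k-th eigenvector of [L i], so [Y i]
       is a nonnegative combination of conjugates of [X]. *)
    pose W k : kern R E (E * T)%type := fun e p => if p.1 == e then (V p.2 k)^* else 0.
    have := @psd_sum R T E xpredT l (fun k => W k ** X ** (W k)^h) (fun k _ => l0 k)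
      (fun k _ => psd_conj (W k) hX).
    congr psd; apply: kernP => e f; rewrite /Y eL -!kmulA tr_kmulC -!kmulA tr_dgM.
    apply: eq_bigr => k _; congr (_ * _).
    rewrite kmul_pair (@sum_only1 _ _ _ f) => [|g gf]; last first.
      by rewrite /kmul big1 // => a _; rewrite /kadj /W /= (negbTE gf) conjC0 mulr0.
    rewrite kmulA /kmul; apply: eq_bigr => a _; rewrite /kadj /W /= eqxx conjCK; congr (_ * _).
    transitivity ((W k ** X) e (f, a)); first by [].
    rewrite kmul_pair (@sum_only1 _ _ _ e) => [|g ge]; last first.
      by rewrite /kmul big1 // => b _; rewrite /W /= (negbTE ge) mul0r.
    by rewrite /kmul; apply: eq_bigr => b _; rewrite /W /= eqxx.
  (* The output is block diagonal over outcomes: a [cq] operator with all weights 1 and its factors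
     swapped. *)
  have := psd_relabel (fun u : E * M => (u.2, u.1)) (cq_psd (fun _ : M => ler01 : 0 <= (1 : R)) hY).
  congr psd; apply: kernP => -[e i] [f j]; rewrite /cq /id_tens /meas /Y /=.
  by case: eqP => // _; rewrite mul1r.
- move=> X; transitivity (\sum_i tr (L i ** X)).
    by apply: eq_bigr => i _; rewrite /meas eqxx.
  rewrite -[in RHS](kmul1k X).
  rewrite -hI /tr exchange_big /=; apply: eq_bigr => a _.
  rewrite /kmul exchange_big /=; apply: eq_bigr => b _.
  by rewrite -mulr_suml.
Qed.

Lemma spec_dg (T : finType) (d : T -> R) : (forall i, 0 <= d i) -> spec (dg d) (@idop R T) d.
Proof.
by move=> d0; split=> //; [split|]; rewrite ?kadj1 ?kmul1k ?kmulk1.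
Qed.

Lemma psd_tr_mul (T : finType) (X Y : op R T) : psd X -> psd Y -> 0 <= tr (X ** Y).
Proof.
move=> /spectral [V [p [_ p0 ->]]] hY; rewrite -!kmulA tr_kmulC -!kmulA tr_dgM.
apply: sumr_ge0 => i _; rewrite mulr_ge0 ?ler0c // kmulA.
by have := psd_diag i (psd_conj (V^h) hY); rewrite kadjK.
Qed.

(* Fano's inequality in the Donsker-Varadhan form, with test function [ln #|M|] on the diagonal
   [m = i] and [0] elsewhere. *)
Lemma fano_classical (M : finType) (r : M -> M -> R) (w : R) (rb : M -> R) : (0 < #|M|)%N ->
  w = (#|M|%:R)^-1 -> (forall i, rb i = \sum_m w * r m i) ->
  (forall m i, 0 <= r m i) -> (forall m, \sum_i r m i = 1) ->
  (\sum_m w * r m m) * ln #|M|%:R - ln 2 <=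
  \sum_m w * \sum_i r m i * (ln (r m i) - ln (rb i)).
Proof.
move=> M0 ew erb r0 r1; set K : R := #|M|%:R in ew *.
have K0 : 0 < K by rewrite ltr0n.
have w0 : 0 < w by rewrite ew invr_gt0.
have l2 : 0 < 2 :> R by [].
have sw : \sum_(m : M) w = 1 by rewrite sumr_const -mulr_natl ew divff // gt_eqF.
have rb0 i : 0 <= rb i by rewrite erb; apply: sumr_ge0 => m _; rewrite mulr_ge0 // ltW.
have srb : \sum_i rb i = 1.
  under eq_bigr => i _ do rewrite erb.
  rewrite exchange_big /= -sw; apply: eq_bigr => m _.
  by rewrite -mulr_sumr r1 mulr1.
(* [G] is the exponential of the test function. *)
pose G (m i : M) : R := if m == i then K else 1.
have G0 m i : 0 < G m i by rewrite /G; case: eqP.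
(* This is ln y <= y - 1 at y = rb i G / (2 r m i). The 2 normalises: the weighted sum of
   [rb i * G m i] is 1 + w (K - 1) <= 2. *)
have key m i : r m i * ln (G m i) - r m i * ln 2 + r m i - rb i * G m i / 2 <=
    r m i * (ln (r m i) - ln (rb i)).
  have [->|rn] := eqVneq (r m i) 0.
    by rewrite !mul0r subrr add0r sub0r oppr_le0 divr_ge0 // mulr_ge0 // ltW.
  have rp : 0 < r m i by rewrite lt0r rn r0.
  have rbp : 0 < rb i.
    rewrite erb (bigD1 m) //= ltr_pwDl ?mulr_gt0 //.
    by apply: sumr_ge0 => k _; rewrite mulr_ge0 // ltW.
  have y0 : 0 < rb i * G m i / (2 * r m i) by rewrite divr_gt0 ?mulr_gt0.
  have : ln (rb i * G m i / (2 * r m i)) <= rb i * G m i / (2 * r m i) - 1.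
    rewrite -[X in ln X](subrK 1) addrC; apply: le_ln1Dx.
    by rewrite -subr_gt0 opprK subrK.
  rewrite ln_div ?posrE ?mulr_gt0 // !lnM ?posrE //.
  rewrite -(ler_pM2l rp) => h.
  have e : r m i * (rb i * G m i / (2 * r m i) - 1) = rb i * G m i / 2 - r m i.
    by field; rewrite gt_eqF.
  rewrite e in h; lra.
apply: (@le_trans _ _ (\sum_m w * \sum_i (r m i * ln (G m i) - r m i * ln 2 + r m i - rb i * G m i / 2))).
  have e1 m : \sum_i (r m i * ln (G m i) - r m i * ln 2 + r m i - rb i * G m i / 2) =
      r m m * ln K - ln 2 + 1 - (1 + (K - 1) * rb m) / 2.
    rewrite sumrB big_split /= sumrB -!mulr_suml r1 mul1r.
    congr (_ - _ + _ - _ / _).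
      rewrite (bigD1 m) //= /G eqxx big1 ?addr0 // => i im.
      by rewrite eq_sym (negbTE im) ln1 mulr0.
    transitivity (\sum_i rb i + \sum_i (if m == i then (K - 1) * rb i else 0)).
      rewrite -big_split /=; apply: eq_bigr => i _; rewrite /G.
      by case: eqP => _; ring.
    by rewrite srb -big_mkcond /= (big_pred1 m) // => i; rewrite eq_sym.
  under [X in _ <= X]eq_bigr => m _ do rewrite e1.
  have -> : \sum_m w * (r m m * ln K - ln 2 + 1 - (1 + (K - 1) * rb m) / 2) =
     (\sum_m w * r m m) * ln K + (\sum_(m : M) w) * (1 / 2 - ln 2) - w * (K - 1) / 2 * \sum_m rb m.
    rewrite !mulr_suml mulr_sumr -big_split -sumrB /=; apply: eq_bigr => m _.
    by field.
  rewrite sw srb mul1r mulr1.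
  have : w * (K - 1) <= 1.
    by rewrite mulrBr ew mulVf ?gt_eqF // mulr1 gerBl -ew ltW.
  lra.
by apply: ler_sum => m _; rewrite ler_pM2l //; apply: ler_sum => i _.
Qed.

Lemma prob_uniform (M : finType) : (0 < #|M|)%N ->
  prob_distr (fun _ : M => (#|M|%:R)^-1 : R).
Proof.
move=> M0; split=> [m|]; first by rewrite invr_ge0.
by rewrite sumr_const -[LHS]mulr_natl divff // pnatr_eq0 -lt0n.
Qed.

(** Measuring does not increase [chi]. The measured states are diagonal, so their [chi] is the
    classical mutual information of message and guess; the loss ln 2 becomes one bit. *)
Lemma fano (M T : finType) (L : M -> op R T) (rho : M -> op R T) : (0 < #|M|)%N -> povm L ->
  (forall m, density (rho m)) ->
  complex.Re ((#|M|%:R)^-1 * \sum_m tr (L m ** rho m)) * log2 #|M|%:R - 1 <=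
  chi (fun _ => (#|M|%:R)^-1) rho.
Proof.
move=> M0 hL hr; set w : R := (#|M|%:R)^-1.
have K0 : 0 < (#|M|%:R : R) by rewrite ltr0n.
have hw : prob_distr (fun _ : M => w) := prob_uniform M0.
have hc := meas_channel hL; apply: le_trans (chi_mono hc hw hr).
pose r m i := complex.Re (tr (L i ** rho m)).
have rE m i : (r m i)%:C = tr (L i ** rho m).
  by apply/RRe_real/ger0_real/psd_tr_mul; [apply: hL.1 | case: (hr m)].
have r0 m i : 0 <= r m i.
  by rewrite -ler0c rE; apply: psd_tr_mul; [apply: hL.1 | case: (hr m)].
have mE m : meas L (rho m) = dg (r m).
  by apply: kernP => i j; rewrite /meas /dg rE; case: eqP.
have r1 m : \sum_i r m i = 1.
  apply: (@complexI R); rewrite -(spec_sum (spec_dg (r0 m))) -mE.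
  by case: hc => _ _ ->; case: (hr m).
pose rb i := \sum_m w * r m i.
have aE : avg (fun _ : M => w) (fun m => meas L (rho m)) = dg rb.
  apply: kernP => i j; rewrite /avg /dg /rb.
  under eq_bigr => m _ do rewrite mE /dg mulrnAr -rmorphM.
  by rewrite sumrMnl -rmorph_sum.
have rb0 i : 0 <= rb i by apply: sumr_ge0 => m _; rewrite mulr_ge0 // invr_ge0.
rewrite /chi aE (entropy_spec (spec_dg rb0)).
under [X in _ <= _ - X]eq_bigr => m _ do rewrite mE (entropy_spec (spec_dg (r0 m))).
have l2 : 0 < ln 2 :> R by rewrite ln_gt0 // ltr1n.
have l2n : ln 2 != 0 :> R by rewrite gt_eqF.
rewrite -(ler_pM2l l2).
have -> : complex.Re ((#|M|%:R)^-1 * \sum_m tr (L m ** rho m)) = \sum_m w * r m m.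
  under eq_bigr => m _ do rewrite -rE.
  rewrite -rmorph_sum /= -mulr_sumr.
  have -> : (#|M|%:R)^-1 = w%:C by rewrite /w fmorphV /= rmorph_nat.
  by rewrite -rmorphM.
have h := fano_classical M0 (erefl w) (fun i => erefl (rb i)) r0 r1.
apply: le_trans (le_trans _ h) _; rewrite {h}.
  by rewrite /log2 le_eqVlt; apply/orP; left; apply/eqP; field.
have etaE x : ln 2 * eta x = - (x * ln x) :> R by rewrite /eta /log2; field.
have A : ln 2 * (\sum_i eta (rb i)) = - \sum_m w * \sum_i r m i * ln (rb i).
  rewrite mulr_sumr -sumrN; transitivity (\sum_i \sum_m - (w * (r m i * ln (rb i)))).
    apply: eq_bigr => i _; rewrite etaE {1}/rb mulr_suml -sumrN.
    by apply: eq_bigr => m _; rewrite mulrA.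
  by rewrite exchange_big /=; apply: eq_bigr => m _; rewrite sumrN mulr_sumr.
have B : ln 2 * (\sum_m w * \sum_i eta (r m i)) = - \sum_m w * \sum_i r m i * ln (r m i).
  rewrite mulr_sumr -sumrN; apply: eq_bigr => m _.
  rewrite mulrCA -mulrN; congr (_ * _); rewrite mulr_sumr -sumrN.
  by apply: eq_bigr => i _; rewrite etaE.
rewrite mulrBr A B opprK addrC -sumrB le_eqVlt; apply/orP; left; apply/eqP.
apply: eq_bigr => m _; rewrite -mulrBr -sumrB; congr (_ * _).
by apply: eq_bigr => i _; rewrite mulrBr.
Qed.

(** Fano bounds (1 - eps) log2 |M| - 1 by the final [chi], which is at most [beta] times the number
    of calls; divide by that number. *)
Lemma protocol_rate (X A B : finType) (N : X -> op R A -> op R B) (beta rate eps : R) (n : nat) :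
  (forall x, channel (N x)) ->
  (forall (E : finType) (p : X -> R) (r : X -> op R (E * A)%type), prob_distr p ->
     (forall y, density (r y)) ->
     cmi (cqstate p (fun y => id_tens (N y) (r y))) - cmi (cqstate p r) <= beta) ->
  eps < 1 -> reading_protocol N n.+1 rate eps ->
  (1 - eps) * rate <= beta + n.+1%:R^-1.
Proof.
move=> hN hb e1 [M [enc [Rs [rho0 [ad [L [h0 had hL hrate hsucc]]]]]]].
have n0 : 0 < n.+1%:R :> R by rewrite ltr0n.
(* With no messages the success probability evaluates to 0, which contradicts eps < 1. *)
have M0 : (0 < #|M|)%N.
  case: (posnP #|M|) => // M0; move: hsucc.
  by rewrite M0 invr0 mul0r /= leNgt subr_gt0 e1.
pose w : M -> R := fun _ => (#|M|%:R)^-1.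
have hw : prob_distr w := prob_uniform M0.
have [hd hc] := run_chi enc hN hb hw h0 had (leqnn n).
have hf := fano M0 hL hd.
have lK : 0 <= log2 #|M|%:R :> R.
  by rewrite divr_ge0 // ln_ge0 ?ler1n.
have h : (1 - eps) * log2 #|M|%:R - 1 <= n.+1%:R * beta.
  apply: le_trans hc; apply: le_trans hf; rewrite lerD2r.
  by apply: ler_wpM2r => //; apply: hsucc.
apply: (@le_trans _ _ ((1 - eps) * (log2 #|M|%:R / n.+1%:R))).
  by rewrite ler_pM2l // subr_gt0.
rewrite mulrA ler_pdivrMr // [leRHS]mulrDl mulVf ?gt_eqF // -lerBlDr.
by rewrite [beta * _]mulrC.
Qed.

End Reading.

(* From the rate bound to the capacity *)
Local Close Scope kern_scope.
Unset Implicit Arguments.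

Theorem mainTheorem9 (R : realType) (X A B : finType)
  (N : X -> op R A -> op R B) (HN : forall x, channel (N x)) :
  (reading_capacity N <= cq_bound N)%E.
Proof.
apply: ge_ereal_sup => _ [r hr <-]; rewrite leNgt; apply/negP => hlt.
have [beta br hb] : exists2 beta : R, beta < r & forall (E : finType) (p : X -> R)
    (rho : X -> op R (E * A)%type), prob_distr p -> (forall y, density (rho y)) ->
     cmi (cqstate p (fun y => id_tens (N y) (rho y))) - cmi (cqstate p rho) <= beta.
  have ub (E : finType) (p : X -> R) (rho : X -> op R (E * A)%type) : prob_distr p ->
      (forall y, density (rho y)) ->
      ((cmi (cqstate p (fun y => id_tens (N y) (rho y))) - cmi (cqstate p rho))%:E <= cq_bound N)%E.
    by move=> hp hd; apply: ereal_sup_ubound; exists E, p, rho.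
  (* A finite bound is itself [beta]; +oo cannot lie below [r]; if the bound is -oo no admissible
     ensemble exists, and any number below [r] serves. *)
  case: (cq_bound N) hlt ub => [b| |]; first 1 last.
  - by rewrite ltNge leey.
  - move=> _ ub; exists (r - 1); first by rewrite gtrBl.
    by move=> E p rho hp hd; have := ub E p rho hp hd; rewrite leNgt ltNyr.
  by rewrite lte_fin => br ub; exists b => // E p rho hp hd; rewrite -lee_fin; apply: ub.
pose g := r - beta; have g0 : 0 < g by rewrite subr_gt0.
(* [D] is chosen so that eps = delta / D satisfies eps < 1 and eps (r - delta) <= delta. With 1/n <
   delta the rate bound then gives r - 2 delta < beta + delta, that is g < 3 g / 4. *)
pose delta := g / 4; have d0 : 0 < delta by rewrite divr_gt0.
pose D := `|r - delta| + 1 + g; have D0 : 0 < D by rewrite /D; have := normr_ge0 (r - delta); lra.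
pose eps := delta / D.
have eD : eps * D = delta by rewrite divfK // gt_eqF.
have e0 : 0 < eps by rewrite divr_gt0.
have e1 : eps < 1.
  by rewrite ltr_pdivrMr // mul1r /D /delta; have := normr_ge0 (r - g / 4); lra.
have e01 : 0 < eps < 1 by rewrite e0.
have [n0 hn] := hr eps delta e01 d0.
(* Large enough for the protocol to exist with n + 1 calls and for 1/(n + 1) < delta. *)
pose n := maxn n0 (Num.truncn delta^-1).
have /(protocol_rate HN hb e1) h := hn n.+1 (leqW (leq_maxl _ _)) isT.
have hi : n.+1%:R^-1 < delta.
  rewrite -[delta]invrK ltf_pV2 ?posrE ?invr_gt0 ?ltr0n //.
  apply: lt_le_trans (truncnS_gt _) _.
  by rewrite ler_nat ltnS leq_maxr.
have hR : eps * (r - delta) <= delta.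
  rewrite -[leRHS]eD ler_pM2l //; apply: le_trans (ler_norm _) _.
  by rewrite /D -addrA lerDl addr_ge0 // ltW.
move: h hR hi; rewrite mulrBl mul1r; move: (eps * (r - delta)) (n.+1%:R^-1) => u v.
by rewrite /delta /g; lra.
Qed.
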